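(* Let $\delta\in(0,n]$, $p\in[1,\infty)$, $q\in(0,\infty)$ and $w\in\mathcal A_{p,\delta}$. Then there exists a positive constant $C$ such that, for any $f\in \mathrm{BLO}(\mathbb R^n,\mathcal H_\infty^\delta)$, $$\frac1C\|f\|_{\mathrm{BLO}(\mathbb R^n,\mathcal H_\infty^\delta)}\le\|f\|_{\mathrm{BLO}^q_w(\mathbb R^n,\mathcal H_\infty^\delta)}\le C\|f\|_{\mathrm{BLO}(\mathbb R^n,\mathcal H_\infty^\delta)}.$$
   Context: A cube $Q\subset\mathbb R^n$ is always left-open and right-closed with sides parallel to the coordinate axes; $l(Q)$ is its edge length. For $\delta\in(0,n]$ and $E\subset\mathbb R^n$ the Hausdorff content is $\mathcal H_\infty^\delta(E)=\inf\{\sum_i l(Q_i)^\delta: E\subset\bigcup_iQ_i\}$, the infimum over all finite or countable coverings by cubes. For any (not necessarily measurable) $f\ge0$, the Choquet integral is $\int_E f\,d\mathcal H_\infty^\delta=\int_0^\infty\mathcal H_\infty^\delta(\{x\in E:f(x)>t\})\,dt$. $L^1_{\rm loc}(\mathbb R^n,\mathcal H_\infty^\delta)$ is the set of functions with $\int_K|f|\,d\mathcal H_\infty^\delta<\infty$ for every compact $K$. A weight is a function $w\in L^1_{\rm loc}(\mathbb R^n,\mathcal H_\infty^\delta)$ with $w\in(0,\infty)$ $\mathcal H_\infty^\delta$-a.e. (i.e. outside a set of content zero). For $p\in(1,\infty)$, $\mathcal A_{p,\delta}$ is the set of weights with $[w]_{\mathcal A_{p,\delta}}=\sup_Q\{\frac1{\mathcal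 H_\infty^\delta(Q)}\int_Q w\,d\mathcal H_\infty^\delta\}\{\frac1{\mathcal H_\infty^\delta(Q)}\int_Q w^{-\frac1{p-1}}\,d\mathcal H_\infty^\delta\}^{p-1}<\infty$ (supremum over all cubes); $\mathcal A_{1,\delta}$ is the set of weights with $[w]_{\mathcal A_{1,\delta}}=\inf\{c\in(0,\infty):\mathcal M_{\mathcal H_\infty^\delta}w\le c\,w\ \ \mathcal H_\infty^\delta\text{-a.e.}\}<\infty$, where $\mathcal M_{\mathcal H_\infty^\delta}w(x)=\sup_{Q\ni x}\frac1{\mathcal H_\infty^\delta(Q)}\int_Q|w|\,d\mathcal H_\infty^\delta$. $w_{\mathcal H_\infty^\delta}(E)=\int_E w\,d\mathcal H_\infty^\delta$. For real-valued $f$ and a cube $Q$, $\operatorname{ess\,inf}_{y\in Q}f(y)=\inf\{t\in\mathbb R:\mathcal H_\infty^\delta(\{x\in Q:f(x)<t\})>0\}$. $\mathrm{BLO}(\mathbb R^n,\mathcal H_\infty^\delta)$ is the set of $f\in L^1_{\rm loc}(\mathbb R^n,\mathcal H_\infty^\delta)$ with $$\|f\|_{\mathrm{BLO}(\mathbb R^n,\mathcal H_\infty^\delta)}=\sup_Q\frac1{\mathcal H_\infty^\delta(Q)}\int_Q\left|f(x)-\operatorname*{ess\,inf}_{y\in Q}f(y)\right|d\mathcal H_\infty^\delta<\infty$$ (infinite if some essential infimum is $-\infty$), and $$\|f\|_{\mathrm{BLO}^q_w(\mathbb R^n,\mathcal H_\infty^\delta)}=\sup_Q\left[\frac1{w_{\mathcal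 H_\infty^\delta}(Q)}\int_Q\left|f(x)-\operatorname*{ess\,inf}_{y\in Q}f(y)\right|^qw(x)\,d\mathcal H_\infty^\delta\right]^{1/q},$$ suprema over all cubes $Q$. *)

(* Defs.v *)
From HB Require Import structures.
From mathcomp Require Import all_boot all_order all_algebra.
From mathcomp Require Import all_classical all_reals all_analysis.

Set Implicit Arguments.
Unset Strict Implicit.
Unset Printing Implicit Defensive.

Import Order.TTheory GRing.Theory Num.Theory.
Import numFieldNormedType.Exports.

Local Open Scope classical_set_scope.
Local Open Scope ring_scope.
Local Open Scope ereal_scope.

Record cube (R : realType) (n : nat) := Cube {
  corner : 'rV[R]_n;
  edge : {posnum R}
}.

Definition cube_set (R : realType) (n : nat) (Q : cube R n) : set 'rV[R]_n :=
  [set x | forall i : 'I_n,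
     (corner Q ord0 i < x ord0 i <= corner Q ord0 i + (edge Q)%:num)%R].

Coercion cube_set : cube >-> set.

(* The index set [I] may be finite (even empty) or infinite, so that finite and
   countable coverings are both allowed. *)
Definition Hcontent (R : realType) (n : nat) (delta : R)
    (E : set 'rV[R]_n) : \bar R :=
  ereal_inf [set s | exists (I : set nat) (Q : nat -> cube R n),
    E `<=` \bigcup_(i in I) cube_set (Q i) /\
    s = \esum_(i in I) (((edge (Q i))%:num `^ delta)%R)%:E].

Definition Hae (R : realType) (n : nat) (delta : R)
    (P : 'rV[R]_n -> Prop) : Prop :=
  Hcontent delta [set x | ~ P x] = 0.

(* The integrand in [t] is nonincreasing, hence measurable, for every [f],
   measurable or not. *)
Definition choquet (R : realType) (n : nat) (delta : R)
    (E : set 'rV[R]_n) (f : 'rV[R]_n -> \bar R) : \bar R :=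
  \int[@lebesgue_measure R]_(t in `]0%R, +oo[)
    Hcontent delta [set x | E x /\ t%:E < f x].

Definition choquet_avg (R : realType) (n : nat) (delta : R)
    (Q : cube R n) (f : 'rV[R]_n -> \bar R) : \bar R :=
  (Hcontent delta Q)^-1 * choquet delta Q f.

Definition L1loc (R : realType) (n : nat) (delta : R)
    (f : 'rV[R]_n -> \bar R) : Prop :=
  forall K : set 'rV[R]_n, compact K ->
    choquet delta K (fun x => `|f x|) < +oo.

(* Weights are extended-real valued: they are constrained only off a set of
   content zero. *)
Definition weight (R : realType) (n : nat) (delta : R)
    (w : 'rV[R]_n -> \bar R) : Prop :=
  L1loc delta w /\ Hae delta (fun x => 0 < w x < +oo).

(* [w ^ (- 1 / (p - 1))] is written [(w ^ (1 / (p - 1)))^-1], which takes the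
   values [+oo] at [w = 0] and [0] at [w = +oo]; [poweR] with a negative
   exponent does not. *)
Definition Ap_const (R : realType) (n : nat) (delta p : R)
    (w : 'rV[R]_n -> \bar R) : \bar R :=
  ereal_sup (range (fun Q : cube R n =>
    choquet_avg delta Q w *
    poweR (choquet_avg delta Q (fun x => (poweR (w x) (1 / (p - 1))%R)^-1))
          (p - 1)%R)).

Definition maximal (R : realType) (n : nat) (delta : R)
    (w : 'rV[R]_n -> \bar R) (x : 'rV[R]_n) : \bar R :=
  ereal_sup [set choquet_avg delta Q (fun y => `|w y|) |
    Q in [set Q : cube R n | cube_set Q x]].

Definition A1_const (R : realType) (n : nat) (delta : R)
    (w : 'rV[R]_n -> \bar R) : \bar R :=
  ereal_inf [set c%:E | c in [set c : R |
    (0 < c)%R /\ Hae delta (fun x => maximal delta w x <= c%:E * w x)]].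

Definition Aclass (R : realType) (n : nat) (delta p : R)
    (w : 'rV[R]_n -> \bar R) : Prop :=
  weight delta w /\
  (if p == 1%R then A1_const delta w else Ap_const delta p w) < +oo.

Definition essinf (R : realType) (n : nat) (delta : R)
    (Q : cube R n) (f : 'rV[R]_n -> R) : \bar R :=
  ereal_inf [set t%:E | t in [set t : R |
    0 < Hcontent delta [set x | cube_set Q x /\ (f x < t)%R]]].

(* If some [essinf delta Q f] is [-oo], the integrand is [+oo] on [Q] and the
   norm is [+oo]. *)
Definition BLO_norm (R : realType) (n : nat) (delta : R)
    (f : 'rV[R]_n -> R) : \bar R :=
  ereal_sup (range (fun Q : cube R n =>
    choquet_avg delta Q (fun x => `|(f x)%:E - essinf delta Q f|))).

Definition BLO (R : realType) (n : nat) (delta : R)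
    (f : 'rV[R]_n -> R) : Prop :=
  L1loc delta (EFin \o f) /\ BLO_norm delta f < +oo.

Definition BLOqw_norm (R : realType) (n : nat) (delta q : R)
    (w : 'rV[R]_n -> \bar R) (f : 'rV[R]_n -> R) : \bar R :=
  ereal_sup (range (fun Q : cube R n =>
    poweR ((choquet delta Q w)^-1 *
           choquet delta Q
             (fun x => poweR `|(f x)%:E - essinf delta Q f| q * w x))
          (1 / q)%R)).

(* Main.v *)
Require Import Defs.
From HB Require Import structures.
From mathcomp Require Import all_boot all_order all_algebra.
From mathcomp Require Import all_classical all_reals all_analysis.
From mathcomp Require Import measurable_realfun ring lra.

Set Implicit Arguments.
Unset Strict Implicit.
Unset Printing Implicit Defensive.

Import Order.TTheory GRing.Theory Num.Theory.
Import numFieldNormedType.Exports.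

Local Open Scope classical_set_scope.
Local Open Scope ring_scope.
Local Open Scope ereal_scope.

(* Write H for the content, w(E) for the integral of w over E, and e_Q for the
   essential infimum of f on Q.

   The content is not additive, so complements are useless and a
   Calderon-Zygmund family of cubes need not be packed.  What replaces them is a
   covering lemma: if E is a small portion of Q, then E is covered by cubes
   P_j of Q with H(E /\ P_j) <= H(P_j) / 2 and sum_j H(P_j) <= C H(E).

   For a weight, A_p gives: if {w <= t} occupies a portion tau of P, then the
   average of w over P is at most c_tau t.  Applied to cubes, this yields that
   w(E) small relative to w(Q) forces H(E) small relative to H(Q).  Applied to
   the P_j that cover {w > t}, it yields w({w > t}) <= C t H({w > t}), hence
   geometric decay of the tail integrals of H({w > t}) (a reverse Hoelder
   inequality), hence w(E) <= (a 2^k H(E)/H(Q) + gam^k) w(Q) with gam < 1.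

   For f, since e_(P_j) <= e_Q + k lam for the P_j that cover {f > e_Q + k lam},
   the bound H(Q /\ {f > e_Q + lam}) <= eta H(Q) for all Q and a small eta
   self-improves to the decay H(Q /\ {f > e_Q + k lam}) <= 4^-k H(Q).

   Chebyshev's inequality gives the hypothesis of this John-Nirenberg estimate
   from either norm, with lam proportional to the norm; summing over the layers
   k lam < f - e_Q <= (k + 1) lam bounds the other norm. *)

(** * Hausdorff content *)

Lemma le_esumZl (R : realType) (T : choiceType) (I : set T)
    (a : T -> \bar R) (c : R) :
  (0 <= c)%R -> (forall i, 0 <= a i) ->
  \esum_(i in I) (c%:E * a i) <= c%:E * \esum_(i in I) a i.
Proof.
move=> c0 a0; apply: ge_ereal_sup => _ [X [finX XI] <-].
rewrite -ge0_mule_fsumr//; apply: lee_wpmul2l => //.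
by apply: ereal_sup_ubound; exists X.
Qed.

Lemma esum_subset (R : realType) (T : choiceType) (I J : set T) (a : T -> \bar R) :
  I `<=` J -> \esum_(i in I) a i <= \esum_(i in J) a i.
Proof.
move=> IJ; apply: ge_ereal_sup => _ [X [finX XI] <-].
by apply: ereal_sup_ubound; exists X => //; split=> //; exact: subset_trans IJ.
Qed.

(** Replaces a norm [x], which may be zero or infinite, by an arbitrary positive real bound [A] that
    can safely be divided; [A] then decreases to [x]. *)
Lemma le_of_real_bounds (R : realType) (x y : \bar R) (c : R) : (0 < c)%R -> 0 <= x ->
  (forall A : R, (0 < A)%R -> x <= A%:E -> y <= (c * A)%:E) -> y <= c%:E * x.
Proof.
move=> c0; case: x => [x| |]// x0 yA; last by rewrite gt0_muley ?lte_fin ?leey.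
apply/lee_addgt0Pr => e e0.
rewrite lee_fin in x0.
apply: le_trans (yA (x + e / c)%R _ _) _.
- by rewrite ltr_wpDl// divr_gt0.
- by rewrite lee_fin lerDl ltW// divr_gt0.
- by rewrite -EFinM -EFinD lee_fin mulrDr mulrCA mulfV ?mulr1// gt_eqF.
Qed.

Section hausdorff_content.
Context {R : realType} {n : nat} (delta : R).
Local Notation H := (@Hcontent R n delta).
Implicit Types (E F : set 'rV[R]_n) (P Q : cube R n).

Lemma Hcontent_cover (T : countType) (I : set T) (Q : T -> cube R n) E :
  E `<=` \bigcup_(i in I) Q i ->
  H E <= \esum_(i in I) ((edge (Q i))%:num `^ delta)%:E.
Proof.
move=> EQ; pose Q0 : cube R n := Cube 0%R (PosNum ltr01).
apply: ereal_inf_lbound.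
exists (pickle @` I), (fun m => odflt Q0 (omap Q (unpickle m))); split.
  move=> x /EQ[i Ii Qx]; exists (pickle i); first by exists i.
  by rewrite pickleK.
rewrite esum_image/=; last by move=> i j _ _; exact: (pcan_inj (@pickleK T)).
by apply: eq_esum => i Ii; rewrite pickleK.
Qed.

Lemma Hcontent_lt E x : H E < x -> exists (I : set nat) (Q : nat -> cube R n),
  E `<=` \bigcup_(i in I) Q i /\
  \esum_(i in I) ((edge (Q i))%:num `^ delta)%:E < x.
Proof. by move=> /ereal_inf_lt[_ [I [Q [EQ ->]]] sx]; exists I, Q. Qed.

Lemma Hcontent_ge0 E : 0 <= H E.
Proof.
apply: le_ereal_inf_tmp => _ [I [Q [_ ->]]]; apply: esum_ge0 => i _.
by rewrite lee_fin powR_ge0.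
Qed.

Lemma Hcontent_set0 : H set0 = 0.
Proof.
apply/eqP; rewrite eq_le Hcontent_ge0 andbT.
rewrite -[leRHS](@esum_set0 R nat (fun=> 1)); apply: ereal_inf_lbound.
exists set0, (fun=> Cube 0%R (PosNum ltr01)); split => //.
by rewrite !esum_set0.
Qed.

Lemma Hcontent_sub E F : E `<=` F -> H E <= H F.
Proof.
move=> EF; apply: ereal_inf_le_tmp => _ [I [Q [FQ ->]]].
by exists I, Q; split => //; exact: subset_trans FQ.
Qed.

Lemma Hcontent_cube_le Q : H Q <= ((edge Q)%:num `^ delta)%:E.
Proof.
apply: le_trans (Hcontent_cover (I := [set tt]) (Q := fun=> Q) _) _.
  by move=> x Qx; exists tt.
by rewrite esum_set1// lee_fin powR_ge0.
Qed.

Lemma Hcontent_cube_lty Q : H Q < +oo.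
Proof. exact: le_lt_trans (Hcontent_cube_le Q) (ltry _). Qed.

Lemma Hcontent_bigcup (J : set nat) (F : nat -> set 'rV[R]_n) E :
  E `<=` \bigcup_(j in J) F j -> H E <= \esum_(j in J) H (F j).
Proof.
move=> EF.
have [|fin] := pselect (exists2 j, J j & H (F j) = +oo).
  move=> [j Jj Fj]; rewrite (_ : \esum_(_ in _) _ = +oo) ?leey//.
  apply/eqP; rewrite -leye_eq -Fj.
  apply: esum_ge; exists [set j]; last by rewrite fsbig_set1.
  by split=> // _ ->.
apply/lee_addgt0Pr => e e0.
(* The errors e / 2^(j+1) allowed in the near-optimal coverings of the [F j] add up to e. *)
pose r j : R := (e / (2 ^ j.+1)%:R)%R.
have r0 j : (0 < r j)%R by rewrite /r divr_gt0// ltr0n expn_gt0.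
have /choice[I] : forall j, exists IQ : set nat * (nat -> cube R n), J j ->
    F j `<=` \bigcup_(i in IQ.1) IQ.2 i /\
    \esum_(i in IQ.1) ((edge (IQ.2 i))%:num `^ delta)%:E <= H (F j) + (r j)%:E.
  move=> j; have [Jj|/contrapT nJj] := pselect (~ J j).
    by exists (set0, fun=> Cube 0%R (PosNum ltr01)).
  have [|I [Q [FQ /ltW sI]]] := @Hcontent_lt (F j) (H (F j) + (r j)%:E).
    rewrite lteDl ?lte_fin// ge0_fin_numE ?Hcontent_ge0//.
    by rewrite ltey; apply/eqP => Fj; apply: fin; exists j.
  by exists (I, Q).
move=> IP.
pose K : set (nat * nat) := J `*`` (fun j => (I j).1).
have /(Hcontent_cover (I := K)) : E `<=` \bigcup_(k in K) (I k.1).2 k.2.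
  move=> x /EF[j Jj /(proj1 (IP j Jj))[i Ii Qx]].
  by exists (j, i).
move=> /le_trans; apply.
rewrite -(@esum_esum _ _ _ J (fun j => (I j).1)
  (fun j i => ((edge ((I j).2 i))%:num `^ delta)%:E)); last first.
  by move=> *; rewrite lee_fin powR_ge0.
apply: le_trans (_ : _ <= \esum_(j in J) (H (F j) + (r j)%:E)) _.
  by apply: le_esum => j Jj; have [] := IP j Jj.
rewrite esumD; last 2 first.
- by move=> *; exact: Hcontent_ge0.
- by move=> *; rewrite lee_fin (ltW (r0 _)).
rewrite leeD2l//; apply: le_trans (epsilon_trick0 xpredT (ltW e0)).
rewrite nneseries_esumT; last by move=> *; rewrite lee_fin (ltW (r0 _)).
rewrite [leRHS](esumID J); last by move=> *; rewrite lee_fin (ltW (r0 _)).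
rewrite setTI leeDl//.
by apply: esum_ge0 => *; rewrite lee_fin (ltW (r0 _)).
Qed.

Lemma Hcontent_bigcup0 (F : nat -> set 'rV[R]_n) E :
  E `<=` \bigcup_j F j -> (forall j, H (F j) = 0) -> H E = 0.
Proof.
move=> /Hcontent_bigcup EF F0; apply/eqP; rewrite eq_le Hcontent_ge0 andbT.
by apply: le_trans EF _; rewrite esum1.
Qed.

Lemma Hcontent_setU E F G : G `<=` E `|` F -> H G <= H E + H F.
Proof.
move=> GEF; pose A j := if j == 0%N then E else F.
have : G `<=` \bigcup_(j in [set` [:: 0%N; 1%N]]) A j.
  by move=> x /GEF[Ex|Fx]; [exists 0%N|exists 1%N]; rewrite //= inE.
move=> /Hcontent_bigcup/le_trans; apply.
rewrite esum_fset; [|exact: finite_seq|by move=> *; exact: Hcontent_ge0].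
by rewrite -fsbig_seq//= !big_cons big_nil adde0.
Qed.

(** The homothety that takes Q onto P, of ratio [k], turns a covering of Q into a covering of P and
    multiplies every edge by [k]. *)
Lemma Hcontent_dilate P Q :
  H P <= (((edge P)%:num / (edge Q)%:num) `^ delta)%:E * H Q.
Proof.
set p := (edge P)%:num; set q := (edge Q)%:num.
have q0 : (0 < q)%R by rewrite /q.
have : (0 < p / q)%R by rewrite divr_gt0// /p /q.
set k := (p / q)%R => k0.
have kd : (0 < k `^ delta)%R by rewrite powR_gt0.
rewrite -lee_pdivrMl//; apply: le_ereal_inf_tmp => _ [I [C [QC ->]]].
rewrite lee_pdivrMl//.
pose D i : cube R n :=
  Cube (\row_j (corner P ord0 j + k * (corner (C i) ord0 j - corner Q ord0 j)))%R
    (PosNum (mulr_gt0 k0 [gt0 of (edge (C i))%:num])).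
have : P `<=` \bigcup_(i in I) D i.
  move=> x Px.
  pose y : 'rV[R]_n :=
    \row_j (corner Q ord0 j + k^-1 * (x ord0 j - corner P ord0 j))%R.
  have xE j : x ord0 j =
      (corner P ord0 j + k * (y ord0 j - corner Q ord0 j))%R.
    rewrite mxE [(corner Q _ _ + _)%R]addrC addrK mulrA mulfV ?gt_eqF// mul1r.
    by rewrite addrC subrK.
  have Qy : cube_set Q y.
    move=> j; have := Px j; rewrite xE ltrDl lerD2l pmulr_rgt0// subr_gt0.
    move=> /andP[-> ]; rewrite -/p (_ : p = k * q)%R; last by rewrite /k divfK ?gt_eqF.
    by rewrite ler_pM2l// lerBlDl.
  have [i Ii Cy] := QC _ Qy; exists i => // j; have /andP[Cy1 Cy2] := Cy j.
  rewrite mxE xE/= ltrD2l ltr_pM2l// ltrD2r Cy1/= -addrA lerD2l -mulrDr.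
  by rewrite ler_pM2l// -addrAC lerD2r.
move=> /Hcontent_cover/le_trans; apply; apply: le_trans (le_esumZl _ _ _).
- by apply: le_esum => i _ /=; rewrite -EFinM -powRM// ltW.
- exact: ltW.
- by move=> *; rewrite lee_fin powR_ge0.
Qed.

Definition unit_cube : cube R n := Cube 0%R (PosNum ltr01).

(** Dilation in both directions; positivity on all cubes thus reduces to that on one cube. *)
Lemma Hcontent_cubeE Q :
  H Q = ((edge Q)%:num `^ delta)%:E * H unit_cube.
Proof.
apply/eqP; rewrite eq_le; apply/andP; split.
  by apply: le_trans (Hcontent_dilate Q unit_cube) _; rewrite divr1.
have qd : (0 < (edge Q)%:num `^ delta)%R by rewrite powR_gt0.
apply: le_trans (lee_wpmul2l _ (Hcontent_dilate unit_cube Q)) _.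
  by rewrite lee_fin powR_ge0.
rewrite muleA -EFinM -powRM// ?divr_ge0//=.
by rewrite mulrCA mulfV ?gt_eqF// mulr1 powR1 mul1e.
Qed.

End hausdorff_content.

(** * Choquet integrals *)

(** The preimage of an upper ray under a monotone function is an interval. *)
Lemma nonincreasing_emeasurable (R : realType) (D : set R) (f : R -> \bar R) :
  measurable D -> (forall s t, (s <= t)%R -> f t <= f s) -> measurable_fun D f.
Proof.
move=> mD f_ni; apply: (measurability _ (ErealGenOInfty.measurableE R)).
move=> /= _ [_ [r ->] <-]; apply: measurableI => //.
apply: is_interval_measurable => s t fs ft u /andP[_ ut].
move: ft; rewrite /= !in_itv/= !andbT => ft.
by rewrite (lt_le_trans ft)// f_ni.
Qed.

(** * Dilations of the half-line and Lebesgue integrals *)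

Section dilation.
Context {R : realType}.
Local Notation mu := (@lebesgue_measure R).
Variables (c : R) (c0 : (0 < c)%R).

Let dil : measurableTypeR R -> measurableTypeR R := ( *%R c).

Let mdil : measurable_fun setT dil.
Proof. exact: measurable_funM. Qed.

Let cnng : {nonneg R} := NngNum (ltW c0).

(** The right side is a measure in [A] that has the correct value on half-open intervals, so
    uniqueness of Lebesgue measure applies. *)
Lemma lebesgue_measure_dilate (A : set (measurableTypeR R)) : measurable A ->
  mu A = c%:E * mu (dil @^-1` A).
Proof.
pose nu : {measure set (measurableTypeR R) -> \bar R} :=
  mscale cnng (pushforward mu dil).
move=> mA; rewrite -[RHS]/(nu mdil A); move: A mA.
apply: (@lebesgue_measure_unique R (nu mdil)) => _ [[a b] _ <-].
rewrite /nu /= /mscale/= /pushforward.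
rewrite (_ : dil @^-1` _ = `](c^-1 * a)%R, (c^-1 * b)%R]%classic); last first.
  apply/seteqP; split => x; rewrite /= !in_itv/= /dil => /andP[ax xb].
    by rewrite ltr_pdivrMl// ler_pdivlMl// ax.
  by rewrite -ltr_pdivrMl// -ler_pdivlMl// ax.
rewrite !lebesgue_measure_itv/= !lte_fin ltr_pM2l ?invr_gt0//.
case: ifP => _; last by rewrite mule0.
by rewrite -!EFinD -EFinM -mulrBr mulrA divff ?gt_eqF// mul1r.
Qed.

Lemma ge0_integral_dilate (f : R -> \bar R) (D : set R) :
  measurable (D : set (measurableTypeR R)) -> measurable_fun D f -> (forall t, 0 <= f t) ->
  \int[mu]_(t in D) f t = c%:E * \int[mu]_(t in dil @^-1` D) f (c * t)%R.
Proof.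
move=> mD mf f0.
pose nu : {measure set (measurableTypeR R) -> \bar R} :=
  mscale cnng (pushforward mu dil).
transitivity (\int[nu mdil]_(t in D) f t).
  by apply: eq_measure_integral => A mA _; exact: lebesgue_measure_dilate.
rewrite ge0_integral_mscale//; congr (_ * _).
by rewrite ge0_integral_pushforward.
Qed.
End dilation.

Section choquet.
Context {R : realType} {n : nat} (delta : R).
Local Notation H := (@Hcontent R n delta).
Local Notation mu := (@lebesgue_measure R).
Local Notation C := (@choquet R n delta).
Implicit Types (E F : set 'rV[R]_n) (f g : 'rV[R]_n -> \bar R).

Definition superlevel E f (t : R) : set 'rV[R]_n := [set x | E x /\ t%:E < f x].

Lemma superlevel_content_le E f s t : (s <= t)%R ->
  H (superlevel E f t) <= H (superlevel E f s).
Proof.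
move=> st; apply: Hcontent_sub => x [Ex tf]; split => //.
by apply: le_lt_trans tf; rewrite lee_fin.
Qed.

Lemma measurable_superlevel_content E f (D : set R) : measurable D ->
  measurable_fun D (fun t => H (superlevel E f t)).
Proof.
by move=> mD; apply: nonincreasing_emeasurable => // s t; exact: superlevel_content_le.
Qed.

Lemma choquetE E f :
  C E f = \int[mu]_(t in `]0%R, +oo[) H (superlevel E f t).
Proof. by []. Qed.

Lemma choquet_ge0 E f : 0 <= C E f.
Proof. by apply: integral_ge0 => t _; exact: Hcontent_ge0. Qed.

Lemma le_choquet E F f g :
  (forall t, (0 < t)%R -> H (superlevel E f t) <= H (superlevel F g t)) ->
  C E f <= C F g.
Proof.
move=> EF; rewrite !choquetE; apply: ge0_le_integral => //=.
- by move=> *; exact: Hcontent_ge0.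
- exact: measurable_superlevel_content.
- exact: measurable_superlevel_content.
- by move=> t; rewrite in_itv/= andbT => t0; exact: EF.
Qed.

(** At each level t > 0 the superlevel sets of the pieces cover that of [f]; countable subadditivity
    of the content is integrated in t, and sum and integral are exchanged. A single index dominates
    [f] at each point, so no integral of a sum of functions occurs. *)
Lemma choquet_bigcup (J : set nat) (F : nat -> set 'rV[R]_n)
    (g : nat -> 'rV[R]_n -> \bar R) E f :
  (forall x, E x -> 0 < f x -> exists j, [/\ J j, F j x & f x <= g j x]) ->
  C E f <= \esum_(j in J) C (F j) (g j).
Proof.
move=> EF; rewrite esum_mkcond -nneseries_esumT; last first.
  by move=> j; case: ifP => // _; exact: choquet_ge0.
pose h j t : \bar R := if j \in J then H (superlevel (F j) (g j) t) else 0.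
have h0 j t : 0 <= h j t by rewrite /h; case: ifP => // _; exact: Hcontent_ge0.
have mh j : measurable_fun (`]0%R, +oo[%classic : set R) (h j).
  rewrite /h; case: (j \in J) => //; exact: measurable_superlevel_content.
rewrite [leRHS](_ : _ = \sum_(j <oo) \int[mu]_(t in `]0%R, +oo[) h j t); last first.
  by apply: eq_eseriesr => j _; rewrite /h; case: (j \in J); rewrite ?integral0.
rewrite -integral_nneseries//; apply: ge0_le_integral => //=.
- by move=> *; exact: Hcontent_ge0.
- exact: measurable_superlevel_content.
- by apply: ge0_emeasurable_sum => // j _; exact: mh.
- move=> t t0; have {}t0 : (0 < (t : R))%R by case/andP: t0.
  rewrite [leRHS](_ : _ = \esum_(j in J) H (superlevel (F j) (g j) t)); last first.
    by rewrite esum_mkcond nneseries_esumT.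
  apply: Hcontent_bigcup => x [Ex tf].
  have [|j [Jj Fx fg]] := EF _ Ex; first by apply: lt_trans tf.
  by exists j => //; split => //; exact: lt_le_trans fg.
Qed.

(** Change of variable t -> c t in the level. *)
Lemma choquetZ E f (c : R) : (0 < c)%R ->
  C E (fun x => c%:E * f x) = c%:E * C E f.
Proof.
move=> c0; rewrite choquetE (@ge0_integral_dilate _ c c0)//; last 2 first.
- exact: measurable_superlevel_content.
- by move=> *; exact: Hcontent_ge0.
rewrite choquetE; congr (_ * _).
rewrite (_ : _ @^-1` _ = `]0%R, +oo[%classic).
  apply: eq_integral => t _; congr (H _); apply/seteqP; split => x [Ex tf]; split => //.
    by move: tf; rewrite EFinM lte_pmul2l.
  by rewrite EFinM lte_pmul2l.
by apply/seteqP; split => t /=; rewrite !in_itv/= !andbT pmulr_rgt0.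
Qed.

Lemma choquet_markov E f (t : R) : (0 < t)%R ->
  t%:E * H (superlevel E f t) <= C E f.
Proof.
move=> t0; rewrite choquetE.
apply: le_trans (_ : _ <= \int[mu]_(s in `]0%R, t]) H (superlevel E f s)) _.
  apply: le_trans (_ : _ <= \int[mu]_(s in `]0%R, t]) cst (H (superlevel E f t)) s) _.
    by rewrite integral_cst//= lebesgue_measure_itv/= lte_fin t0 oppr0 addr0 muleC.
  apply: ge0_le_integral => //=.
  - by move=> *; exact: Hcontent_ge0.
  - exact: measurable_superlevel_content.
  - by move=> s; rewrite in_itv/= => /andP[_]; exact: superlevel_content_le.
apply: ge0_subset_integral => //.
- exact: measurable_superlevel_content.
- by move=> *; exact: Hcontent_ge0.
- by move=> s /=; rewrite !in_itv/= andbT => /andP[].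
Qed.

(** Lets the constant 1 serve as the weight when the unweighted norm is estimated. *)
Lemma choquet1 E : C E (fun=> 1) = H E.
Proof.
pose I : set R := `]0%R, 1%R[%classic.
transitivity (\int[mu]_(t in `]0%R, +oo[) (cst (H E) \_ I) t).
  apply: eq_integral => t /set_mem/andP[t0 _]; rewrite patchE.
  case: ifPn => [|/negP tI].
    move=> /set_mem/andP[_ t1].
    by congr (H _); apply/seteqP; split => [x []//|x Ex]; split; rewrite ?lte_fin.
  rewrite (_ : [set x | _] = set0); first exact: Hcontent_set0.
  rewrite -subset0 => x [Ex]; rewrite lte_fin => t1; apply: tI.
  by apply/mem_set/andP.
rewrite -integral_mkcondr (_ : _ `&` _ = I); last first.
  apply/seteqP; split => [t []//|t /= It]; split => //.
  by case/andP: It => t0 _; apply/andP.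
have := @lebesgue_measure_itv R `]0%R, 1%R[; rewrite -/I /= lte_fin ltr01 oppr0 adde0 => I1.
have mI : measurable I by exact: measurable_itv.
transitivity (H E * mu I); first exact: integral_cst.
by rewrite I1 mule1.
Qed.
End choquet.

(** * Dyadic stopping cubes *)

Section dyadic_cubes.
Context {R : realType} {n : nat}.
Variable Q : cube R n.
Implicit Types (x y : 'rV[R]_n) (k : nat).

Definition dyadic_edge k : R := ((edge Q)%:num / 2 ^+ k)%R.

Lemma dyadic_edge_gt0 k : (0 < dyadic_edge k)%R.
Proof. by rewrite divr_gt0// exprn_gt0. Qed.

Lemma dyadic_edgeS k : (dyadic_edge k = 2 * dyadic_edge k.+1)%R.
Proof.
by rewrite /dyadic_edge exprS invfM mulrCA mulVKf.
Qed.

(** The fibres of the ceiling are the intervals ]m - 1, m], which matches left-open right-closed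
    cubes. *)
Definition dyadic_index k x (i : 'I_n) : int :=
  Num.ceil ((x ord0 i - corner Q ord0 i) / dyadic_edge k)%R.

Definition same_dyadic k x y := forall i, dyadic_index k x i = dyadic_index k y i.

(** A dyadic cube is named by any of its points; the grid of Q is extended to the whole space. *)
Definition dyadic k x : cube R n :=
  Cube (\row_i (corner Q ord0 i + dyadic_edge k * (dyadic_index k x i - 1)%:~R))%R
    (PosNum (dyadic_edge_gt0 k)).

Lemma dyadicP k x y : cube_set (dyadic k x) y <-> same_dyadic k x y.
Proof.
have e0 := dyadic_edge_gt0 k.
have side (m : int) :
    (dyadic_edge k * (m - 1)%:~R + dyadic_edge k = m%:~R * dyadic_edge k)%R.
  by rewrite mulrC intrB mulrBl mul1r subrK.
split=> xy i.
  have /andP[xy1 xy2] := xy i; apply/esym/ceil_def/andP; split.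
    by rewrite ltr_pdivlMr// ltrBrDl mulrC; move: xy1; rewrite mxE.
  rewrite ler_pdivrMr// lerBlDl; apply: le_trans xy2 _.
  by rewrite /= mxE -addrA lerD2l side.
have /andP[xy1 xy2] := ceil_itv ((y ord0 i - corner Q ord0 i) / dyadic_edge k)%R.
apply/andP; rewrite /= mxE xy; split.
  by move: xy1; rewrite ltr_pdivlMr// ltrBrDl mulrC.
move: xy2; rewrite ler_pdivrMr// lerBlDl => /le_trans; apply.
by rewrite -addrA lerD2l side.
Qed.

Lemma same_dyadic_sym k x y : same_dyadic k x y -> same_dyadic k y x.
Proof. by move=> xy i. Qed.

Lemma same_dyadic_trans k y x z :
  same_dyadic k x y -> same_dyadic k y z -> same_dyadic k x z.
Proof. by move=> xy yz i; rewrite xy. Qed.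

(** The ceiling of z / 2 is at most m exactly when that of z is at most 2 m, so it depends only on
    the ceiling of z. This is the nesting of consecutive dyadic grids. *)
Lemma ceil_half (u v : R) : Num.ceil u = Num.ceil v ->
  Num.ceil (u / 2)%R = Num.ceil (v / 2)%R.
Proof.
have half (z : R) (m : int) : (Num.ceil (z / 2) <= m)%R = (Num.ceil z <= m * 2)%R.
  by rewrite !ceil_le_int ler_pdivrMr// intrM.
by move=> uv; apply/eqP; rewrite eq_le half uv -half lexx half -uv -half lexx.
Qed.

Lemma same_dyadicW k k' x y : (k <= k')%N ->
  same_dyadic k' x y -> same_dyadic k x y.
Proof.
move=> /subnK <-; elim: (k' - k)%N => [//|m IHm] xy; apply: IHm => i.
have half z : ((z ord0 i - corner Q ord0 i) / dyadic_edge (m + k) =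
    (z ord0 i - corner Q ord0 i) / dyadic_edge (m + k).+1 / 2)%R.
  by rewrite dyadic_edgeS invfM mulrA mulrAC.
by rewrite /dyadic_index !half; apply: ceil_half; exact: xy.
Qed.

Lemma dyadic_sub k k' x : (k <= k')%N -> dyadic k' x `<=` dyadic k x.
Proof. by move=> kk' y /dyadicP/(same_dyadicW kk')/dyadicP. Qed.

Lemma dyadic0 x : cube_set Q x -> cube_set (dyadic 0 x) = Q.
Proof.
move=> Qx; have idx y : cube_set Q y -> forall i, dyadic_index 0 y i = 1%R.
  move=> Qy i; apply: ceil_def; rewrite subrr mulr0z /dyadic_edge expr0 divr1.
  have /andP[y1 y2] := Qy i.
  by rewrite divr_gt0//= ?subr_gt0// ler_pdivrMr// mul1r lerBlDl.
have E : forall i, dyadic_index 0 x i = 1%R by exact: idx.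
apply/seteqP; split => y; last first.
  by move=> Qy; apply/dyadicP => i; rewrite !idx.
by move=> xy i; have := xy i; rewrite /= mxE E subrr mulr0z mulr0 addr0 /dyadic_edge expr0 divr1.
Qed.

(** An interval no longer than the mesh meets at most two consecutive grid intervals, so [P] meets
    at most 2^n dyadic cubes of generation [k]. *)
Lemma dyadic_index_cube (P : cube R n) k : ((edge P)%:num <= dyadic_edge k)%R ->
  exists m : 'I_n -> int, forall x, cube_set P x -> forall i,
    dyadic_index k x i = m i \/ dyadic_index k x i = (m i + 1)%R.
Proof.
move=> Pk; have e0 := dyadic_edge_gt0 k.
exists (fun i => Num.floor ((corner P ord0 i - corner Q ord0 i) / dyadic_edge k)%R + 1)%R.
move=> x Px i; set u := ((corner P ord0 i - _) / _)%R.
have /andP[x1 x2] := Px i.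
have ux : (u < (x ord0 i - corner Q ord0 i) / dyadic_edge k <= u + 1)%R.
  rewrite ltr_pM2r ?invr_gt0// ltrD2r x1/=.
  rewrite ler_pdivrMr// mulrDl mul1r divfK ?gt_eqF//.
  by rewrite addrAC lerD2r (le_trans x2)// lerD2l.
case/andP: ux => ux1 ux2; set v := (_ / _)%R in ux1 ux2 *.
have /andP[u1 u2] := floor_itv u.
have [vu|vu] := leP v (Num.floor u + 1)%:~R; [left|right]; apply: ceil_def.
  by rewrite addrK vu andbT (le_lt_trans u1).
by rewrite addrK vu/= (le_trans ux2)// intrD lerD2r ltW.
Qed.

(** Take the least k with edge at most 2 e: the previous edge exceeds 2 e, so this one exceeds e.
    For k = 0 the bound e <= l(Q) is used instead. *)
Lemma ex_dyadic_edge (e : R) : (0 < e <= (edge Q)%:num)%R ->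
  exists k, (e <= dyadic_edge k <= 2 * e)%R.
Proof.
move=> /andP[e0 eQ].
have ex : exists k, (dyadic_edge k <= 2 * e)%R.
  pose N := (Num.trunc ((edge Q)%:num / e)).+1; exists N.
  rewrite /dyadic_edge ler_pdivrMr ?exprn_gt0// mulrAC.
  apply: le_trans (_ : _ <= 2 ^+ N * e)%R _; last first.
    by rewrite ler_wpM2r// ?(ltW e0)// ler_peMl ?exprn_ge0// ler1n.
  rewrite -ler_pdivrMr//; apply: ltW; apply: lt_le_trans (truncnS_gt _) _.
  by rewrite -natrX ler_nat ltnW// ltn_expl.
exists (ex_minn ex); case: ex_minnP => -[|k] k2 min; rewrite k2 andbT.
  by rewrite /dyadic_edge expr0 divr1.
rewrite -(ler_pM2l (x := 2%R))// -dyadic_edgeS leNgt; apply/negP => /ltW /min.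
by rewrite ltnn.
Qed.
End dyadic_cubes.

(** * Passing from arbitrary coverings to dyadic ones *)

Section dyadic_covering.
Context {R : realType} {n : nat} (delta : R).
Hypothesis delta_gt0 : (0 < delta)%R.
Local Notation H := (@Hcontent R n delta).

Lemma dyadic_cover : exists2 K : R, (1 <= K)%R &
  forall (Q : cube R n) (E : set 'rV[R]_n) (A : R), E `<=` Q ->
    H E < A%:E -> (A <= (edge Q)%:num `^ delta)%R ->
  exists (J : set nat) (k : nat -> nat) (x : nat -> 'rV[R]_n),
    [/\ forall j, J j -> E (x j),
        E `<=` \bigcup_(j in J) dyadic Q (k j) (x j) &
        \esum_(j in J) (dyadic_edge Q (k j) `^ delta)%:E <= (K * A)%:E].
Proof.
pose S : finType := {ffun 'I_n -> bool}.
pose N : \bar R := \esum_(s in [set: S]) 1.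
have N1 : 1 <= N.
  by rewrite -(@esum_set1 R S [ffun=> false] (fun=> 1))//; exact: esum_subset.
have Nfin : N \is a fin_num.
  rewrite ge0_fin_numE ?(le_trans _ N1)// /N.
  rewrite esum_fset; [|exact: finite_finset|by []].
  by rewrite fsumEFin ?ltry//; exact: finite_finset.
have d2 : (1 <= 2 `^ delta :> R)%R.
  have := @ge0_ler_powR R delta (ltW delta_gt0) 1%R 2%R.
  by rewrite powR1 !nnegrE ler1n => ->.
(* [N] dyadic cubes replace each covering cube, and their edges are at most twice as long. *)
exists (fine N * 2 `^ delta)%R.
  by rewrite mulr_ege1// -lee_fin fineK.
move=> Q E A EQ HA AQ.
have [I [P [EP PA]]] := Hcontent_lt HA.
(* A longer cube would alone cost more than l(Q)^delta >= A. *)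
have Pe i : I i -> ((edge (P i))%:num <= (edge Q)%:num)%R.
  move=> Ii; rewrite leNgt; apply/negP => QP.
  have : ((edge (P i))%:num `^ delta)%:E < A%:E.
    apply: le_lt_trans PA; apply: esum_ge; exists [set i]; last by rewrite fsbig_set1.
    by split=> // _ ->.
  rewrite lte_fin => /lt_le_trans/(_ AQ).
  by rewrite ltNge ltW// gt0_ltr_powR// nnegrE.
have /choice[k kP] : forall i, exists k, I i ->
    ((edge (P i))%:num <= dyadic_edge Q k <= 2 * (edge (P i))%:num)%R.
  move=> i; have [Ii|/contrapT nIi] := pselect (~ I i); first by exists 0%N.
  have [|k Pk] := @ex_dyadic_edge _ _ Q (edge (P i))%:num; last by exists k.
  by rewrite Pe// andbT.
have /choice[m mP] : forall i, exists m : 'I_n -> int, I i ->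
    forall x, cube_set (P i) x -> forall l,
    dyadic_index Q (k i) x l = m l \/ dyadic_index Q (k i) x l = (m l + 1)%R.
  move=> i; have [Ii|/contrapT nIi] := pselect (~ I i); first by exists (fun=> 0%R).
  have /andP[Pk _] := kP _ nIi.
  by have [m mP] := dyadic_index_cube Pk; exists m.
(* Records, coordinate by coordinate, which of the two possible indices a point of [P i] has; two
   points with the same pattern share a dyadic cube. *)
pose pattern i (y : 'rV[R]_n) : S := [ffun l => dyadic_index Q (k i) y l == m i l].
have patternP i y z : I i -> cube_set (P i) y -> cube_set (P i) z ->
    pattern i y = pattern i z -> same_dyadic Q (k i) y z.
  move=> Ii Py Pz /ffunP yz l; have := yz l; rewrite !ffunE.
  have [->|->] := mP i Ii _ Py l; have [->|->] := mP i Ii _ Pz l => //.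
  - by rewrite eqxx => /esym/eqP->.
  - by rewrite eqxx => /eqP->.
pose T : countType := (nat * S)%type.
pose B (t : T) : set 'rV[R]_n := [set y | [/\ E y, cube_set (P t.1) y & pattern t.1 y = t.2]].
(* Only the pieces that meet E are kept, so that each dyadic cube can be named by a point of E. *)
pose J : set T := [set t | I t.1 /\ exists y, B t y].
have /choice[x xP] : forall t, exists y, J t -> B t y.
  move=> t; have [Jt|/contrapT nJt] := pselect (~ J t); first by exists 0%R.
  by have [_ [y By]] := nJt; exists y.
pose t0 : T := (0%N, [ffun=> false]).
pose f (j : nat) : T := odflt t0 (unpickle j).
have fK t : f (pickle t) = t by rewrite /f pickleK.
exists (pickle @` J), (fun j => k (f j).1), (fun j => x (f j)); split.
- by move=> _ [t Jt <-]; rewrite fK; have [] := xP _ Jt.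
- move=> y Ey; have [i Ii Py] := EP _ Ey.
  have Jt : J (i, pattern i y) by split => //; exists y.
  exists (pickle (i, pattern i y)); first by exists (i, pattern i y).
  rewrite fK; apply/dyadicP => /=.
  by have [_ Px xy] := xP _ Jt; exact: patternP.
- rewrite esum_image; last by move=> s t _ _ /(congr1 f); rewrite !fK.
  under eq_esum do rewrite fK.
  apply: le_trans (_ : _ <= \esum_(t in I `*`` (fun=> [set: S]))
      ((2 * (edge (P t.1))%:num) `^ delta)%:E) _.
    apply: le_trans (_ : _ <= \esum_(t in J)
      ((2 * (edge (P t.1))%:num) `^ delta)%:E) _; last first.
      by apply: esum_subset => t [].
    apply: le_esum => t [It _]; have /andP[_ kt] := kP _ It.
    by rewrite lee_fin ge0_ler_powR ?nnegrE// ltW// dyadic_edge_gt0.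
  rewrite -(@esum_esum _ _ _ I (fun=> [set: S])
    (fun i _ => ((2 * (edge (P i))%:num) `^ delta)%:E)); last first.
    by move=> *; rewrite lee_fin powR_ge0.
  apply: le_trans (_ : _ <= \esum_(i in I)
     ((fine N * 2 `^ delta)%:E * ((edge (P i))%:num `^ delta)%:E)) _.
    apply: le_esum => i Ii.
    rewrite -[leLHS](eq_esum (fun s _ => mule1 _)).
    apply: le_trans (le_esumZl _ _ _) _ => //; rewrite -/N.
    by rewrite -(fineK Nfin) -!EFinM powRM// lee_fin mulrC mulrA.
  have K0 : (0 <= fine N * 2 `^ delta)%R.
    by rewrite mulr_ge0 ?powR_ge0// fine_ge0// (le_trans _ N1).
  apply: le_trans (le_esumZl _ K0 _) _.
    by move=> i; rewrite lee_fin powR_ge0.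
  by rewrite [leRHS]EFinM lee_wpmul2l// ltW.
Qed.

End dyadic_covering.

Section stopping.
Context {R : realType} {n : nat} (delta : R).
Hypothesis delta_gt0 : (0 < delta)%R.
Local Notation H := (@Hcontent R n delta).

(* The P j are the parents of the maximal dyadic cubes of Q that are heavy for
   a near-optimal dyadic covering (D_j) of E, where D is heavy when the D_j
   inside D have total mass at least th * l(D)^delta: the masses of a covering
   add up over disjoint cubes although the content itself is only subadditive. *)
Lemma stopping_cubes : 0 < H unit_cube ->
  exists th C0 : R, [/\ (0 < th)%R, (0 < C0)%R &
  forall (Q : cube R n) (E : set 'rV[R]_n) (A : R), E `<=` Q ->
    H E < A%:E -> A%:E <= th%:E * H Q ->
  exists (J : set nat) (P : nat -> cube R n),
    [/\ forall j, J j -> P j `<=` Q,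
        E `<=` \bigcup_(j in J) P j,
        forall j, J j -> H (E `&` P j) <= 2^-1%:E * H (P j) &
        \esum_(j in J) H (P j) <= (C0 * A)%:E]].
Proof.
move=> c0; have [K K1 cover] := @dyadic_cover R n delta delta_gt0.
have K0 : (0 < K)%R by rewrite (lt_le_trans _ K1).
set u := H _ in c0; have ufin : u \is a fin_num.
  by rewrite ge0_fin_numE ?ltW// Hcontent_cube_lty.
pose c := fine u; have cE : u = c%:E by rewrite fineK.
have {}c0 : (0 < c)%R by rewrite -lte_fin -cE.
have c1 : (c <= 1)%R.
  by rewrite -lee_fin -cE; apply: le_trans (Hcontent_cube_le _ _) _; rewrite powR1.
have HE (P : cube R n) : H P = (c * (edge P)%:num `^ delta)%:E.
  by rewrite Hcontent_cubeE -/u cE -EFinM mulrC.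
(* Half the content of the unit cube: a cube D with mass below th l(D)^delta has mass below H(D) /
   2. *)
pose th : R := (c / 2)%R.
have th0 : (0 < th)%R by rewrite divr_gt0.
have th1 : (th <= 1)%R by rewrite ler_pdivrMr// mul1r (le_trans c1)// ler1n.
have d2 : (0 < 2 `^ delta :> R)%R by rewrite powR_gt0.
(* The first constant makes the total mass, at most K A, smaller than th l(Q)^delta, so Q itself is
   light. In the second, c 2^delta / th compares H of a parent with the mass of its heavy child, and
   K A bounds the sum of these masses. *)
exists (th / (2 * K * c))%R, (c * 2 `^ delta * K / th)%R; split.
- by rewrite divr_gt0// !mulr_gt0.
- by rewrite divr_gt0// !mulr_gt0.
move=> Q E A EQ EA AQ.
have A0 : (0 < A)%R by rewrite -lte_fin (le_lt_trans _ EA)// Hcontent_ge0.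
have KA : (K * A < th * (edge Q)%:num `^ delta)%R.
  move: AQ; rewrite HE -EFinM lee_fin mulrA.
  rewrite -[X in (_ <= X * _)%R](_ : (th / (2 * K)) = _)%R; last first.
    by rewrite [in RHS]invfM -!mulrA mulVf ?mulr1// gt_eqF.
  rewrite invfM mulrA mulrAC ler_pdivlMr// mulrC => /le_lt_trans; apply.
  by rewrite ltr_pM2r ?powR_gt0// ltr_pdivrMr// ltr_pMr// ltr1n.
have AQ' : (A <= (edge Q)%:num `^ delta)%R.
  rewrite -(ler_pM2l K0); apply: le_trans (ltW KA) _.
  by rewrite ler_pM2r ?powR_gt0// (le_trans th1).
have [J [k [x [xE EJ xA]]]] := cover Q E A EQ EA AQ'.
pose l j := dyadic_edge Q j.
have l0 j : (0 < l j)%R by exact: dyadic_edge_gt0.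
(* Indices of the D_j of generation at least m inside the dyadic cube of generation m around y. *)
pose inside m y := [set j | [/\ J j, (m <= k j)%N & same_dyadic Q m y (x j)]].
pose mass m y : \bar R := \esum_(j in inside m y) (l (k j) `^ delta)%:E.
pose heavy m y := `[< (th * l m `^ delta)%:E <= mass m y >].
have mass_ge0 m y : 0 <= mass m y.
  by apply: esum_ge0 => *; rewrite lee_fin powR_ge0.
have massE m y z : same_dyadic Q m y z -> mass m y = mass m z.
  move=> yz; congr (esum _ _); apply/seteqP; split => j [Jj mk /same_dyadic_sym jy].
    by split => //; apply/same_dyadic_sym/(same_dyadic_trans jy).
  by split => //; apply/same_dyadic_sym/(same_dyadic_trans jy)/same_dyadic_sym.
have heavyk j : J j -> heavy (k j) (x j).
  move=> Jj; apply/asboolP; apply: esum_ge; exists [set j].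
    by split => // _ ->.
  by rewrite fsbig_set1 lee_fin ler_piMl// powR_ge0.
have light0 y : ~~ heavy 0%N y.
  apply/asboolPn; apply/negP; rewrite -ltNge.
  apply: le_lt_trans (_ : _ <= (K * A)%:E) _.
    by apply: le_trans (esum_subset _ _) xA => j [].
  by rewrite lte_fin /l /dyadic_edge expr0 divr1.
(* The largest heavy cube around [x j] has generation [(m j).+1], so [m j] is the generation of its
   parent, which is light. Generation 0 is light, hence the successor. *)
have /choice[m mP] : forall j, exists m, J j ->
    [/\ heavy m.+1 (x j), (m < k j)%N & forall i, heavy i (x j) -> (m < i)%N].
  move=> j; have [Jj|/contrapT nJj] := pselect (~ J j); first by exists 0%N.
  have ex : exists i, heavy i (x j) by exists (k j); exact: heavyk.
  case: (ex_minnP ex) => -[|m]; first by rewrite (negbTE (light0 _)).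
  by move=> hm min; exists m => _; split => //; apply: min; exact: heavyk.
(* Indices with the same maximal heavy cube; [J0] keeps the least index of each class. *)
pose eqv i j := m i = m j /\ same_dyadic Q (m i).+1 (x i) (x j).
pose J0 : set nat := [set j | J j /\ forall i, J i -> eqv j i -> (j <= i)%N].
pose P j := dyadic Q (m j) (x j).
have PE j : H (P j) = (c * 2 `^ delta * l (m j).+1 `^ delta)%:E.
  by rewrite HE /= dyadic_edgeS powRM ?mulrA// ltW// l0.
exists J0, P; split.
- by move=> j [Jj _]; rewrite -(dyadic0 (EQ _ (xE _ Jj))); exact: dyadic_sub.
- move=> y Ey; have [j Jj /dyadicP jy] := EJ _ Ey; have [hm mk min] := mP _ Jj.
  have ex : exists i, `[< J i /\ eqv j i >] by exists j; apply/asboolP.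
  case: (ex_minnP ex) => i /asboolP[Ji [mij xij]] imin; exists i.
    split => // i' Ji' [mii' xii']; apply: imin; apply/asboolP; split => //.
    by split; [rewrite mij|apply: same_dyadic_trans xij _; rewrite mij].
  apply/dyadicP; rewrite -mij; apply: same_dyadicW (leqnSn _) _.
  by apply: same_dyadic_trans (same_dyadic_sym xij) _; exact: same_dyadicW jy.
- move=> j [Jj _]; have [hm mk min] := mP _ Jj.
  have light : mass (m j) (x j) < (th * l (m j) `^ delta)%:E.
    by rewrite ltNge; apply/negP => /asboolP/min; rewrite ltnn.
  apply: le_trans (_ : _ <= mass (m j) (x j)) _.
    apply: (@Hcontent_cover R n delta nat _ (fun i => dyadic Q (k i) (x i))).
    move=> y [Ey /dyadicP jy]; have [i Ji /dyadicP iy] := EJ _ Ey.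
    exists i; last exact/dyadicP.
    (* A D_i that meets P_j either lies in P_j and is counted in its mass, or is strictly larger;
       then it is a heavy cube around [x j] larger than the maximal one. *)
    have [mi|im] := leqP (m j) (k i).
      split => //; apply: same_dyadic_trans jy _.
      exact/same_dyadic_sym/(same_dyadicW mi).
    have : heavy (k i) (x j).
      have := heavyk _ Ji; rewrite /heavy (@massE _ (x i) (x j))//.
      apply: same_dyadic_trans iy _.
      exact/same_dyadic_sym/(same_dyadicW (ltnW im)).
    by move=> /min; rewrite ltnNge (ltnW im).
  apply: le_trans (ltW light) _; rewrite HE -EFinM lee_fin /th/=.
  by rewrite mulrCA mulrA.
- pose S j := inside (m j).+1 (x j).
  (* Two maximal heavy cubes that contain a common D_a are nested, hence equal by maximality, and
     then so are their least indices. *)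
  have disj i j a : J0 i -> J0 j -> S i a -> S j a -> (m i <= m j)%N -> i = j.
    move=> [Ji imin] [Jj jmin] [Ja ia xia] [_ ja xja] mij.
    have [hi _ mini] := mP _ Ji; have [hj _ minj] := mP _ Jj.
    have xij : same_dyadic Q (m i).+1 (x i) (x j).
      apply: same_dyadic_trans xia _.
      by apply/same_dyadic_sym; exact: same_dyadicW xja.
    have mij' : m i = m j.
      have : heavy (m i).+1 (x j) by move: hi; rewrite /heavy (massE _ _ _ xij).
      by move=> /minj; rewrite ltnS => mji; apply/eqP; rewrite eqn_leq mij.
    apply/eqP; rewrite eqn_leq imin//= jmin//; split => //.
    by apply: same_dyadic_sym; rewrite -mij'.
  apply: le_trans (_ : _ <= \esum_(j in J0)
     ((c * 2 `^ delta / th)%:E * mass (m j).+1 (x j))) _.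
    apply: le_esum => j [Jj _]; have [/asboolP hm _ _] := mP _ Jj.
    rewrite PE; apply: le_trans (lee_wpmul2l _ hm); last first.
      by rewrite lee_fin divr_ge0// ltW// mulr_gt0.
    by rewrite -EFinM lee_fin mulrA divfK// gt_eqF.
  have C0 : (0 <= c * 2 `^ delta / th)%R by rewrite divr_ge0// ltW// mulr_gt0.
  apply: le_trans (le_esumZl _ C0 _) _ => //.
  rewrite (_ : (c * 2 `^ delta * K / th * A = c * 2 `^ delta / th * (K * A))%R); last first.
    by rewrite -!mulrA; do 2 congr (_ * _)%R; rewrite mulrCA.
  rewrite [leRHS]EFinM lee_wpmul2l//; apply: le_trans xA.
  rewrite esum_esum; last by move=> *; rewrite lee_fin powR_ge0.
  (* By disjointness each D_a is counted in at most one mass, so the masses sum to at most the total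
     of the covering. *)
  rewrite -(esum_image _ snd (fun i => (l (k i) `^ delta)%:E)).
    by apply: esum_subset => _ [[i j] [_ [Jj _ _]] <-].
  move=> [i a] [j b] /[!inE]/= -[Ji Sia] [Jj Sja] ab.
  rewrite -{}ab in Sja *; congr (_, _).
  have [mij|/ltnW mji] := leqP (m i) (m j); first exact: (disj i j a).
  by apply/esym; exact: (disj j i a).
Qed.
End stopping.

(** * Muckenhoupt weights *)

Section weights.
Context {R : realType} {n : nat} (delta : R).
Local Notation H := (@Hcontent R n delta).
Local Notation C := (@choquet R n delta).
Local Notation mu := (@lebesgue_measure R).
Hypothesis content_gt0 : 0 < H unit_cube.
Implicit Types (w f : 'rV[R]_n -> \bar R) (Q P : cube R n) (E : set 'rV[R]_n).

Lemma Hcontent_cube_gt0 Q : 0 < H Q.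
Proof. by rewrite Hcontent_cubeE mule_gt0// lte_fin powR_gt0. Qed.

Lemma Hcontent_cube_fin Q : H Q \is a fin_num.
Proof. by rewrite ge0_fin_numE ?Hcontent_cube_lty// ltW// Hcontent_cube_gt0. Qed.

Lemma fine_Hcontent_cube_gt0 Q : (0 < fine (H Q))%R.
Proof. by rewrite fine_gt0// Hcontent_cube_gt0 Hcontent_cube_lty. Qed.

Lemma choquet_avg_le Q f (y : \bar R) : choquet_avg delta Q f <= y ->
  C Q f <= y * H Q.
Proof.
rewrite /choquet_avg -(fineK (Hcontent_cube_fin Q)) inver gt_eqF ?fine_Hcontent_cube_gt0//.
by rewrite lee_pdivrMl ?fine_Hcontent_cube_gt0// muleC.
Qed.

Lemma choquet_avg_ge0 Q f : 0 <= choquet_avg delta Q f.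
Proof. by rewrite mule_ge0 ?choquet_ge0// inve_ge0 ltW// Hcontent_cube_gt0. Qed.

Lemma choquet_avg_ge Q f (y : R) : y%:E * H Q <= C Q f ->
  y%:E <= choquet_avg delta Q f.
Proof.
rewrite /choquet_avg -(fineK (Hcontent_cube_fin Q)) inver gt_eqF ?fine_Hcontent_cube_gt0//.
by rewrite lee_pdivlMl ?fine_Hcontent_cube_gt0// muleC.
Qed.

(* The only consequence of the A_p condition that is used. *)
Definition median_bound w := forall tau : R, (0 < tau)%R ->
  exists2 c : R, (0 < c)%R & forall P (t : R), (0 < t)%R ->
    tau%:E * H P < H [set x | cube_set P x /\ w x <= t%:E] ->
    C P w <= (c * t)%:E * H P.

(** A set of positive content contains a point x with M w(x) <= c w(x) <= c t, and M w(x) dominates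
    the average over P. *)
Lemma A1_median_bound w : A1_const delta w < +oo -> median_bound w.
Proof.
move=> /ereal_inf_lt[_ [c [c0 Mw] <-] _] tau tau0; exists c => // P t t0 Pt.
have [x [[Px xt] Mx]] : exists x, (cube_set P x /\ w x <= t%:E) /\
    maximal delta w x <= c%:E * w x.
  apply: contrapT => nex; move: Pt; apply/negP; rewrite -leNgt.
  apply: le_trans (_ : _ <= H [set x | ~ maximal delta w x <= c%:E * w x]) _.
    by apply: Hcontent_sub => x Px Mx; apply: nex; exists x.
  by rewrite Mw mule_ge0// ?Hcontent_ge0// lee_fin ltW.
have : choquet_avg delta P (fun y => `|w y|) <= (c * t)%:E.
  apply: le_trans (_ : _ <= maximal delta w x) _.
    by apply: ereal_sup_ubound; exists P.
  by apply: le_trans Mx _; rewrite EFinM lee_wpmul2l// lee_fin ltW.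
move=> /choquet_avg_le; apply: le_trans; apply: le_choquet => s _.
by apply: Hcontent_sub => y [Py sw]; split=> //; rewrite (lt_le_trans sw)// lee_abs.
Qed.

(** Where w <= t, the dual weight [sigma] is at least t^(-1/(p-1)), so its average is bounded below;
    the A_p product then bounds the average of w. *)
Lemma Ap_median_bound (p : R) w : (1 < p)%R -> Hae delta (fun x => 0 < w x < +oo) ->
  Ap_const delta p w < +oo -> median_bound w.
Proof.
move=> p1 w0 Ap tau tau0.
have r0 : (0 < p - 1)%R by rewrite subr_gt0.
have [B B0 AB] : exists2 B : R, (0 < B)%R & Ap_const delta p w <= B%:E.
  exists (Num.max (fine (Ap_const delta p w)) 1)%R; first by rewrite lt_max ltr01 orbT.
  by case: (Ap_const _ _ _) Ap => [a| |]//= _; rewrite ?leNye// lee_fin le_max lexx.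
set r := (p - 1)%R in r0 *.
have tr0 : (0 < (tau / 2) `^ r)%R by rewrite powR_gt0// divr_gt0.
exists (B / (tau / 2) `^ r)%R; first by rewrite divr_gt0.
move=> P t t0 Pt.
pose sigma x := (poweR (w x) (1 / r))^-1.
(* The factor 1/2 makes the inequality [sigma] > [s] strict, as superlevel sets require. *)
pose s : R := ((t `^ (1 / r))^-1 / 2)%R.
have ta0 : (0 < t `^ (1 / r))%R by rewrite powR_gt0.
have s0 : (0 < s)%R by rewrite divr_gt0// invr_gt0.
have Ps : H [set x | cube_set P x /\ w x <= t%:E] <= H (superlevel P sigma s).
  rewrite -[leRHS]adde0 -w0; apply: Hcontent_setU => x [Px].
  have [w0x|] := pselect (0 < w x < +oo); last by right.
  move=> wt; left; split=> //; move: w0x wt; rewrite /sigma.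
  case: (w x) => [y| |]; [|by rewrite ltxx andbF|by rewrite ltNge leNye].
  rewrite ltry andbT lte_fin lee_fin => y0 yt.
  have ya : (0 < y `^ (1 / r))%R by rewrite powR_gt0.
  rewrite inver gt_eqF// lte_fin /s ltr_pdivrMr//.
  apply: le_lt_trans (_ : _ <= (y `^ (1 / r))^-1)%R _.
    by rewrite lef_pV2 ?posrE// ge0_ler_powR ?nnegrE ?divr_ge0// ltW.
  by rewrite ltr_pMr ?invr_gt0// ltr1n.
have avgs : (s * tau)%:E <= choquet_avg delta P sigma.
  apply: choquet_avg_ge; apply: le_trans (choquet_markov delta P sigma s0).
  by rewrite EFinM -muleA lee_wpmul2l ?lee_fin ?(ltW s0)// (le_trans _ Ps)// ltW.
have pw : ((s * tau) `^ r = t^-1 * (tau / 2) `^ r)%R.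
  rewrite (_ : s * tau = (t `^ (1 / r))^-1 * (tau / 2))%R; last first.
    by rewrite /s -!mulrA [(2^-1 * _)%R]mulrC.
  have tau2 : (0 <= tau / 2)%R by rewrite divr_ge0// ltW.
  rewrite [LHS]powRM ?invr_ge0 ?powR_ge0//.
  rewrite -powRN -powRrM mulNr div1r mulVf ?gt_eqF//.
  by rewrite powRN powRr1// ltW.
have : (t^-1 * (tau / 2) `^ r)%:E * choquet_avg delta P w <= B%:E.
  apply: le_trans AB; apply: le_trans (_ : _ <= choquet_avg delta P w *
    poweR (choquet_avg delta P sigma) r) _; last first.
    by apply: ereal_sup_ubound; exists P.
  rewrite muleC lee_wpmul2l ?choquet_avg_ge0//.
  rewrite -pw -poweR_EFin; apply: gt0_ler_poweR => //; first exact: ltW.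
    by rewrite in_itv/= leey andbT lee_fin mulr_ge0// ltW.
  by rewrite in_itv/= leey andbT choquet_avg_ge0.
rewrite -lee_pdivlMl ?mulr_gt0 ?invr_gt0// => /choquet_avg_le.
by rewrite -EFinM invfM invrK [(t * _)%R]mulrC mulrAC [(_^-1 * B)%R]mulrC.
Qed.

Lemma Aclass_median_bound p w : (1 <= p)%R -> Aclass delta p w -> median_bound w.
Proof.
rewrite /Aclass => p1 [[_ w0]]; case: eqP => [_|/eqP pN1]; first exact: A1_median_bound.
by apply: Ap_median_bound => //; rewrite lt_neqAle eq_sym pN1.
Qed.

(** If the integral vanished, Markov would make every {w > 1/(k+1)} null, and these sets cover Q up
    to a null set. *)
Lemma choquet_cube_gt0 w Q : Hae delta (fun x => 0 < w x < +oo) -> 0 < C Q w.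
Proof.
move=> w0; rewrite lt_neqAle choquet_ge0 andbT eq_sym; apply/eqP => CQ0.
have := Hcontent_cube_gt0 Q; rewrite ltNge => /negP; apply.
pose F k := superlevel Q w k.+1%:R^-1.
have F0 k : H (F k) = 0.
  apply/eqP; rewrite eq_le Hcontent_ge0 andbT.
  have k0 : (0 < k.+1%:R^-1 :> R)%R by [].
  have := choquet_markov delta Q w k0; rewrite CQ0.
  by rewrite pmule_rle0// lte_fin.
have -> : 0 = H (\bigcup_k F k) + H [set x | ~ 0 < w x < +oo].
  by rewrite w0 adde0; apply/esym; exact: Hcontent_bigcup0 F0.
apply: Hcontent_setU => x Qx.
have [/andP[wx _]|] := pselect (0 < w x < +oo); [left|by right].
case wE : (w x) wx => [r| |]//; last first.
  by move=> _; exists 0%N => //; split => //; rewrite wE ltry.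
rewrite lte_fin => r0; exists (Num.trunc r^-1) => //; split => //.
by rewrite wE lte_fin invf_plt ?posrE// truncnS_gt.
Qed.

(** Q is not closed; local integrability is applied to the closed box around it. *)
Lemma choquet_cube_lty w Q : L1loc delta w -> C Q w < +oo.
Proof.
pose K : set 'rV[R]_n := [set v | forall i,
  `[corner Q ord0 i, (corner Q ord0 i + (edge Q)%:num)%R]%classic (v ord0 i)].
have Kc : compact K.
  apply: (@rV_compact R n
    (fun i => `[corner Q ord0 i, (corner Q ord0 i + (edge Q)%:num)%R]%classic)).
  by move=> i; exact: segment_compact.
move=> /(_ _ Kc); apply: le_lt_trans; apply: le_choquet => t _.
apply: Hcontent_sub => x [Qx tx]; split.
  by move=> i; have /andP[x1 x2] := Qx i; rewrite /= in_itv/= ltW.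
by rewrite (lt_le_trans tx)// lee_abs.
Qed.

End weights.

(** * Weighted integrals against content on subsets of a cube *)

Section A_infty.
Context {R : realType} {n : nat} (delta : R).
Local Notation H := (@Hcontent R n delta).
Local Notation C := (@choquet R n delta).
Local Notation mu := (@lebesgue_measure R).
Hypothesis delta_gt0 : (0 < delta)%R.
Hypothesis content_gt0 : 0 < H unit_cube.
Variable w : 'rV[R]_n -> \bar R.
Hypothesis w_median : median_bound delta w.
Hypothesis w_gt0 : forall Q, 0 < C (cube_set Q) w.
Hypothesis w_lty : forall Q, C (cube_set Q) w < +oo.
Implicit Types (Q P : cube R n) (E : set 'rV[R]_n).

Let w_fin Q : C Q w \is a fin_num.
Proof. by rewrite ge0_fin_numE ?choquet_ge0. Qed.

Let fw_gt0 Q : (0 < fine (C Q w))%R.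
Proof. by rewrite fine_gt0// w_gt0 w_lty. Qed.

(** At the level [s] the median bound would give w(Q) <= w(Q) / 2, so {w <= s} has content at most
    tau H(Q) / 2. Markov bounds the part of E where w > s, and [kappa] is chosen so that it is at
    most tau H(Q) / 2 as well. *)
Lemma choquet_small_content_small (tau : R) : (0 < tau)%R ->
  exists2 kappa : R, (0 < kappa)%R & forall Q E, E `<=` Q ->
    C E w <= kappa%:E * C Q w -> H E <= tau%:E * H Q.
Proof.
move=> tau0; have tau2 : (0 < tau / 2)%R by rewrite divr_gt0.
have [c c0 med] := w_median tau2.
exists (tau / (4 * c))%R; first by rewrite divr_gt0// mulr_gt0.
move=> Q E EQ.
have h0 := fine_Hcontent_cube_gt0 content_gt0 Q.
have W0 := fw_gt0 Q.
have := med Q; rewrite -(fineK (Hcontent_cube_fin content_gt0 Q)) -(fineK (w_fin Q)).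
set h := fine (H Q) in h0 *; set W := fine (C Q w) in W0 * => medQ Ew.
pose s : R := (W / (2 * c * h))%R.
have s0 : (0 < s)%R by rewrite divr_gt0// !mulr_gt0.
have low : H [set x | cube_set Q x /\ w x <= s%:E] <= (tau / 2)%:E * h%:E.
  rewrite leNgt; apply/negP => /(medQ _ s0); apply/negP; rewrite -ltNge.
  rewrite -EFinM lte_fin (_ : c * s * h = W / 2)%R; last first.
    by rewrite /s; field; rewrite !gt_eqF.
  by rewrite ltr_pdivrMr// ltr_pMr// ltr1n.
have high : H (superlevel E w s) <= (tau / 2)%:E * h%:E.
  rewrite -(@lee_pmul2l _ s%:E)//.
  apply: le_trans (choquet_markov delta E w s0) _; apply: le_trans Ew _.
  rewrite -!EFinM lee_fin le_eqVlt; apply/orP; left; apply/eqP.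
  by rewrite /s; field; rewrite !gt_eqF.
rewrite [tau]splitr [in leRHS]EFinD ge0_muleDl ?lee_fin ?(ltW tau2)//.
apply: le_trans (leeD high low); apply: Hcontent_setU => x Ex.
by have [wx|wx] := ltP s%:E (w x); [left|right; split => //; exact: EQ].
Qed.

Let tail Q t := \int[mu]_(s in `]t, +oo[) H (superlevel Q w s).

Let tail_le Q t E : (0 <= t)%R ->
  (forall s, (t < s)%R -> H (superlevel Q w s) <= H (superlevel E w s)) ->
  tail Q t <= C E w.
Proof.
move=> t0 QE; apply: le_trans (_ : _ <= \int[mu]_(s in `]t, +oo[) H (superlevel E w s)) _.
  apply: ge0_le_integral => //=.
  - by move=> *; exact: Hcontent_ge0.
  - exact: measurable_superlevel_content.
  - exact: measurable_superlevel_content.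
  - by move=> s; rewrite in_itv/= andbT => ts; exact: QE.
rewrite choquetE; apply: ge0_subset_integral => //.
- exact: measurable_superlevel_content.
- by move=> *; exact: Hcontent_ge0.
- by move=> s /=; rewrite !in_itv/= !andbT; exact: le_lt_trans.
Qed.

Let tail_split Q (t T : R) : (t <= T)%R ->
  tail Q t = \int[mu]_(s in `]t, T]) H (superlevel Q w s) + tail Q T.
Proof.
move=> tT; rewrite /tail -ge0_integral_setU//.
- by rewrite -itv_bndbnd_setU// bnd_simp.
- by apply: measurable_superlevel_content; exact: measurableU.
- by move=> *; exact: Hcontent_ge0.
- apply/disj_setPS => s [] /=; rewrite !in_itv/= andbT => /andP[_ sT] Ts.
  by move: (lt_le_trans Ts sT); rewrite ltxx.
Qed.

(** The stopping cubes need a bound A strictly above the content; A then decreases to the content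
    itself. *)
Let le_slope (x y B K : R) : (0 < K)%R -> (x < B)%R ->
  (forall A, (x < A <= B)%R -> (y <= K * A)%R) -> (y <= K * x)%R.
Proof.
move=> K0 xB yA; apply/ler_addgt0Pr => e e0.
pose A := Num.min B (x + e / K)%R.
have AB : (x < A <= B)%R by rewrite lt_min xB ltrDl divr_gt0//= ge_min lexx.
apply: le_trans (yA _ AB) _.
apply: le_trans (_ : _ <= K * (x + e / K))%R _.
  by rewrite ler_pM2l// ge_min lexx orbT.
by rewrite mulrDr mulrCA mulfV ?mulr1// gt_eqF.
Qed.

(* Gehring-type differential inequality: the tail Phi t of the distribution
   function phi t = H (Q /\ w > t) satisfies Phi t <= K t phi t for large t,
   since the stopping cubes of {w > t} have w-average O(t).  Hence Phi (2 t)
   <= gam * Phi t with gam < 1. *)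
Lemma choquet_A_infty : exists a gam : R,
  [/\ (0 < a)%R, (0 < gam < 1)%R &
  forall Q E (e : R) k, E `<=` Q -> H E <= e%:E * H Q ->
    C E w <= (a * 2 ^+ k * e + gam ^+ k)%:E * C Q w].
Proof.
have [th [C0 [th0 C00 stop]]] := stopping_cubes delta_gt0 content_gt0.
(* On a stopping cube {w > t} has at most half the content, so {w <= t} has at least half; 1/4
   leaves room for the strict inequality in [median_bound]. *)
have q0 : (0 < 4^-1 :> R)%R by [].
have [c c0 med] := w_median q0.
pose K := (c * C0)%R; have K0 : (0 < K)%R by rewrite mulr_gt0.
(* Adding Phi(2t) <= 2 K t phi(2t) to 2 K times t phi(2t) + Phi(2t) <= Phi(t) gives (1 + 2K) Phi(2t)
   <= 2K Phi(t). *)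
pose gam := (2 * K / (1 + 2 * K))%R.
have K2 : (0 < 2 * K)%R by rewrite mulr_gt0.
have K21 : (0 < 1 + 2 * K)%R by rewrite addr_gt0.
have gam01 : (0 < gam < 1)%R.
  by rewrite divr_gt0//= ltr_pdivrMr// mul1r ltrDr.
exists (2 / th)%R, gam; split => //; first by rewrite divr_gt0.
move=> Q E e k EQ.
have h0 := fine_Hcontent_cube_gt0 content_gt0 Q.
have W0 := fw_gt0 Q.
have hE := fineK (Hcontent_cube_fin content_gt0 Q).
have WE := fineK (w_fin Q).
set h := fine (H Q) in h0 hE; set W := fine (C Q w) in W0 WE.
rewrite -hE -WE => Ee.
pose phi t := H (superlevel Q w t).
have phi_fin t : phi t \is a fin_num.
  rewrite ge0_fin_numE ?Hcontent_ge0//.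
  by apply: le_lt_trans (Hcontent_cube_lty delta Q); apply: Hcontent_sub => x [].
have tail_W t : (0 <= t)%R -> tail Q t <= C Q w by move=> ?; exact: tail_le.
have tail_ge0 t : 0 <= tail Q t by apply: integral_ge0 => *; exact: Hcontent_ge0.
have tail_fin t : (0 < t)%R -> tail Q t \is a fin_num.
  by move=> t0; rewrite ge0_fin_numE// (le_lt_trans (tail_W _ (ltW t0))).
(* From [t0] on, Markov gives phi(t) <= th H(Q) / 2, within the range of the stopping cubes. *)
pose t0 := (2 * W / (th * h))%R.
have t00 : (0 < t0)%R by rewrite divr_gt0// mulr_gt0.
have step1 t : (t0 <= t)%R -> (fine (tail Q t) <= K * t * fine (phi t))%R.
  move=> t0t; have tp : (0 < t)%R by rewrite (lt_le_trans t00).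
  apply: (@le_slope _ _ (th * h)%R); first by rewrite mulr_gt0.
    have := choquet_markov delta Q w tp.
    rewrite -/(phi t) -WE -(fineK (phi_fin t)) -EFinM lee_fin.
    rewrite -ler_pdivlMl// => /le_lt_trans; apply.
    rewrite ltr_pdivrMl//; apply: lt_le_trans (_ : t0 * (th * h) <= _)%R.
      rewrite /t0 divfK ?gt_eqF ?mulr_gt0//.
      by rewrite ltr_pMl// ltr1n.
    by rewrite ler_pM2r// mulr_gt0.
  move=> A /andP[phiA Ah].
  have phiA' : H (superlevel Q w t) < A%:E.
    by rewrite -/(phi t) -(fineK (phi_fin t)) lte_fin.
  have [||J [P [PQ EP EP2 PA]]] := stop Q (superlevel Q w t) A _ phiA'.
  - by move=> x [].
  - by rewrite -hE -EFinM lee_fin.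
  rewrite -lee_fin fineK ?tail_fin//.
  apply: le_trans (_ : _ <= C (superlevel Q w t) w) _.
    apply: tail_le => [|s ts]; first exact: ltW.
    apply: Hcontent_sub => x [Qx sw]; split => //; split => //.
    by rewrite (lt_trans _ sw)// lte_fin.
  apply: le_trans (choquet_bigcup delta (J := J) (F := fun j => cube_set (P j))
    (g := fun=> w) _) _.
    by move=> x /EP[j Jj Px] _; exists j.
  apply: le_trans (_ : _ <= \esum_(j in J) ((c * t)%:E * H (P j))) _.
    apply: le_esum => j Jj; apply: med => //.
    have hp := fine_Hcontent_cube_gt0 content_gt0 (P j).
    have hpE := fineK (Hcontent_cube_fin content_gt0 (P j)).
    have : H (P j) <= H (superlevel Q w t `&` P j) +
        H [set x | cube_set (P j) x /\ w x <= t%:E].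
      apply: Hcontent_setU => x Px; have [tw|wt] := ltP t%:E (w x); last by right.
      by left; split => //; split => //; exact: PQ Px.
    move=> /le_trans/(_ (leeD (EP2 j Jj) (lexx _))); rewrite -hpE.
    set p := fine _ in hp *; set y := H _ => py.
    apply: lt_le_trans (_ : (2^-1 * p)%:E <= _).
      by rewrite lte_fin ltr_pM2r// ltf_pV2 ?posrE // ltr_nat.
    move: py; case: y => [y| |]; [|by move=> _; exact: leey|by rewrite addeNy leeNy_eq].
    rewrite -EFinM -EFinD !lee_fin; lra.
  have ct : (0 <= c * t)%R by rewrite mulr_ge0// ltW.
  apply: le_trans (le_esumZl _ ct _) _; first by move=> *; exact: Hcontent_ge0.
    apply: le_trans (lee_wpmul2l _ PA) _; first by rewrite lee_fin.
  by rewrite -EFinM lee_fin /K mulrACA -!mulrA.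
have step2 t : (t0 <= t)%R -> (fine (tail Q (2 * t)) <= gam * fine (tail Q t))%R.
  move=> t0t; have tp : (0 < t)%R by rewrite (lt_le_trans t00).
  have tt : (t <= 2 * t)%R by rewrite ler_peMl ?ltW// ltr1n.
  have t2p := lt_le_trans tp tt.
  have := tail_split Q tt; set I := \int[mu]_(_ in _) _ => tE.
  have I_ge : (t * fine (phi (2 * t)))%:E <= I.
    rewrite EFinM fineK//.
    apply: le_trans (_ : _ <= \int[mu]_(s in `]t, (2 * t)%R]) cst (phi (2 * t)%R) s) _.
      rewrite integral_cst//= lebesgue_measure_itv/= lte_fin ltr_pMl// ltr1n.
      rewrite (_ : (2 * t)%:E - t%:E = t%:E); last first.
        by rewrite -EFinB; congr EFin; rewrite mulr2n mulrDl mul1r addrK.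
      by rewrite [leRHS]muleC.
    apply: ge0_le_integral => //=.
    - by move=> *; exact: Hcontent_ge0.
    - exact: measurable_superlevel_content.
    - by move=> s; rewrite in_itv/= => /andP[_]; exact: superlevel_content_le.
  have s1 := step1 _ (le_trans t0t tt).
  have I_le : (t * fine (phi (2 * t)) + fine (tail Q (2 * t)) <= fine (tail Q t))%R.
    rewrite -lee_fin EFinD !fineK ?tail_fin// tE leeD2r//.
  have I_le2 := ler_wpM2l (ltW K2) I_le.
  have gK : (gam * (1 + 2 * K) = 2 * K)%R by rewrite divfK ?gt_eqF.
  by rewrite -(ler_pM2r K21) [leRHS]mulrAC gK; lra.
have step3 : (fine (tail Q (2 ^+ k * t0)) <= gam ^+ k * W)%R.
  elim: k => [|k IHk].
    by rewrite expr0 !mul1r -lee_fin fineK ?tail_fin// WE tail_W// ltW.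
  have -> : (2 ^+ k.+1 * t0 = 2 * (2 ^+ k * t0))%R by rewrite exprS mulrA.
  have -> : (gam ^+ k.+1 * W = gam * (gam ^+ k * W))%R by rewrite exprS mulrA.
  apply: le_trans (step2 _ _) _.
    by rewrite ler_peMl ?(ltW t00)// exprn_ege1// ler1n.
  by apply: ler_wpM2l => //; case/andP: gam01 => /ltW.
pose T := (2 ^+ k * t0)%R; have T0 : (0 < T)%R by rewrite mulr_gt0// exprn_gt0.
(* Below the level [T] the integrand is at most H(E); above it the decay of the tail of Q is used.
   The first part is T e H(Q) = (2 / th) 2^k e w(Q), whence the value of [a]. *)
rewrite -EFinM; apply: le_trans (_ : _ <= (T * (e * h))%:E + tail Q T) _.
  rewrite choquetE.
  rewrite (_ : `]0%R, +oo[%classic = `]0%R, T]%classic `|` `]T, +oo[%classic); last first.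
    by rewrite -itv_bndbnd_setU// bnd_simp// ltW.
  rewrite ge0_integral_setU//; last 3 first.
  - by apply: measurable_superlevel_content; exact: measurableU.
  - by move=> *; exact: Hcontent_ge0.
  - apply/disj_setPS => s [] /=; rewrite !in_itv/= andbT => /andP[_ sT] Ts.
    by move: (lt_le_trans Ts sT); rewrite ltxx.
  apply: leeD.
    apply: le_trans (_ : _ <= \int[mu]_(s in `]0%R, T]) cst (H E) s) _.
      apply: ge0_le_integral => //=.
      - by move=> *; exact: Hcontent_ge0.
      - exact: measurable_superlevel_content.
      - by move=> s _; apply: Hcontent_sub => x [].
    rewrite integral_cst//= lebesgue_measure_itv/= lte_fin T0 oppr0 adde0 muleC.
    by rewrite [leRHS]EFinM; apply: lee_wpmul2l; rewrite ?lee_fin ?(ltW T0).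
  apply: ge0_le_integral => //=.
  - by move=> *; exact: Hcontent_ge0.
  - exact: measurable_superlevel_content.
  - exact: measurable_superlevel_content.
  - by move=> s _; apply: Hcontent_sub => x [Ex sw]; split => //; exact: EQ.
rewrite -(fineK (tail_fin _ T0)) -EFinD lee_fin mulrDl lerD//.
by rewrite /T /t0 le_eqVlt; apply/orP; left; apply/eqP; field; rewrite !gt_eqF.
Qed.

End A_infty.

(** * John-Nirenberg inequality *)

Section john_nirenberg.
Context {R : realType} {n : nat} (delta : R).
Local Notation H := (@Hcontent R n delta).
Local Notation C := (@choquet R n delta).
Hypothesis delta_gt0 : (0 < delta)%R.
Hypothesis content_gt0 : 0 < H unit_cube.
Implicit Types (Q P : cube R n) (E : set 'rV[R]_n).

(** The essential infimum enters as an abstract [e], through one property: e P <= t as soon as {f <=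
    t} is not null in P. *)
Lemma john_nirenberg : exists2 eta : R, (0 < eta)%R &
  forall (f : 'rV[R]_n -> R) (e : cube R n -> R) (lam : R),
    (0 < lam)%R ->
    (forall P t, 0 < H [set x | cube_set P x /\ (f x <= t)%R] -> (e P <= t)%R) ->
    (forall Q, H [set x | cube_set Q x /\ (e Q + lam < f x)%R] <= eta%:E * H Q) ->
  forall Q k, H [set x | cube_set Q x /\ (e Q + k.+1%:R * lam < f x)%R] <=
    (4^-1 ^+ k.+1)%:E * H Q.
Proof.
have [th [C0 [th0 C00 stop]]] := stopping_cubes delta_gt0 content_gt0.
pose D := Num.min 1%R th.
have D0 : (0 < D)%R by rewrite lt_min ltr01.
(* The bound D / 8 starts the induction; 1 / (8 C0) turns the constant of the stopping cubes into a
   factor 1/8 < 1/4 per step. *)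
pose eta := Num.min (D / 8)%R (8 * C0)^-1%R.
have eta0 : (0 < eta)%R by rewrite lt_min divr_gt0// invr_gt0 mulr_gt0.
have etaD : (eta <= D / 8)%R by rewrite ge_min lexx.
have etaC : (eta <= (8 * C0)^-1)%R by rewrite ge_min lexx orbT.
exists eta => // f e lam lam0 eP small Q k.
have h0 := fine_Hcontent_cube_gt0 content_gt0 Q.
have hE := fineK (Hcontent_cube_fin content_gt0 Q).
set h := fine (H Q) in h0 hE; rewrite -hE.
pose E k := [set x | cube_set Q x /\ (e Q + k.+1%:R * lam < f x)%R].
pose A k : R := (D * 4^-1 ^+ k.+1 * h)%R.
have A0 i : (0 < A i)%R by rewrite !mulr_gt0// exprn_gt0.
(* The induction needs this strict bound with the factor D <= th, so that [stop] applies to every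
   [E k]. *)
suff : H (E k) < (A k)%:E.
  move=> /ltW/le_trans; apply; rewrite -EFinM lee_fin /A ler_pM2r//.
  by rewrite ler_piMl// ?exprn_ge0// ge_min lexx.
elim: k => [|k IHk].
  rewrite /E mul1r; apply: le_lt_trans (small Q) _.
  rewrite -hE -EFinM lte_fin /A ltr_pM2r// expr1 (le_lt_trans etaD)//.
  by rewrite ltr_pM2l// ltf_pV2 ?posrE// ltr_nat.
have [||J [P [PQ EP EP2 PA]]] := stop Q (E k) (A k) _ IHk.
- by move=> x [].
- rewrite -hE -EFinM lee_fin ler_pM2r//.
  apply: le_trans (_ : _ <= D)%R _; last by rewrite ge_min lexx orbT.
  by rewrite ler_piMr ?(ltW D0)// exprn_ile1// invf_le1// ler1n.
(* [E k] fills at most half of P_j, so {f <= e_Q + (k+1) lam} is not null in P_j. *)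
have eQP j : J j -> (e (P j) <= e Q + k.+1%:R * lam)%R.
  move=> Jj; apply: eP; rewrite lt_neqAle Hcontent_ge0 andbT eq_sym.
  apply/eqP => low0.
  have p0 := fine_Hcontent_cube_gt0 content_gt0 (P j).
  have pE := fineK (Hcontent_cube_fin content_gt0 (P j)).
  have : H (P j) <= H (E k `&` P j) + 0.
    rewrite -low0; apply: Hcontent_setU => x Px.
    have [fx|fx] := leP (f x) (e Q + k.+1%:R * lam)%R; [by right|left].
    by split => //; split => //; exact: PQ Px.
  rewrite adde0 => /le_trans/(_ (EP2 _ Jj)); apply/negP; rewrite -ltNge.
  by rewrite -pE -EFinM lte_fin gtr_pMl// invf_lt1// ltr1n.
apply: le_lt_trans (_ : (eta * (C0 * A k))%:E < _); last first.
  rewrite lte_fin mulrA; apply: le_lt_trans (_ : 8^-1 * A k < _)%R.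
    rewrite ler_pM2r// -ler_pdivlMr//; apply: le_trans etaC _.
    by rewrite invfM.
  have -> : (A k.+1 = 4^-1 * A k)%R by rewrite /A exprS; ring.
  by rewrite ltr_pM2r// ltf_pV2 ?posrE// ltr_nat.
apply: le_trans (Hcontent_bigcup delta (J := J) (F := fun j => E k.+1 `&` P j) _) _.
  move=> x [Qx fx]; have [|j Jj Px] := EP x; last by exists j.
  split => //; apply: le_lt_trans fx; rewrite lerD2l.
  by rewrite ler_pM2r// ler_nat.
apply: le_trans (_ : _ <= \esum_(j in J) (eta%:E * H (P j))) _.
  apply: le_esum => j Jj; apply: le_trans (small (P j)).
  apply: Hcontent_sub => x [[_ fx] Px]; split => //.
  apply: le_lt_trans fx.
  by rewrite -natr1 mulrDl mul1r addrA lerD2r eQP.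
apply: le_trans (le_esumZl _ (ltW eta0) _) _; first by move=> *; exact: Hcontent_ge0.
by rewrite EFinM; apply: lee_wpmul2l => //; rewrite lee_fin ltW.
Qed.

(** The layers have thickness L = (N+1) lam, with N so large that the decay over one layer beats the
    growth of the q-th power. *)
Lemma choquet_layers (q rho K : R) : (0 < q)%R -> (0 < rho < 1)%R -> (0 < K)%R ->
  exists2 B : R, (0 < B)%R &
  forall (E : set 'rV[R]_n) (g : 'rV[R]_n -> R) u (lam V : R),
    (0 < lam)%R -> (0 <= V)%R -> (forall x, 0 <= g x)%R ->
    (forall k, C [set x | E x /\ (k%:R * lam < g x)%R] u <= (K * rho ^+ k * V)%:E) ->
  C E (fun x => poweR (g x)%:E q * u x) <= ((lam * B) `^ q * K * 2 * V)%:E.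
Proof.
move=> q0 /andP[rho0 rho1] K0.
pose m := (Num.trunc q).+1.
have qm : (q <= m%:R)%R by rewrite ltW// truncnS_gt.
have [N rhoN] : exists N, (rho ^+ N < (2 ^+ m.+1)^-1)%R.
  have : (fun k => rho ^+ k)%R @ \oo --> (0%R : R).
    by apply: cvg_expr; rewrite ger0_norm// ltW.
  have e0 : (0 < (2 ^+ m.+1)^-1 :> R)%R by rewrite invr_gt0 exprn_gt0.
  move=> /cvgr0Pnorm_lt/(_ _ e0)[N _ /(_ N (leqnn N))] /=.
  by rewrite ger0_norm ?exprn_ge0 ?(ltW rho0)// => ?; exists N.
(* (k+1)^q <= 2^(m k) and rho^(N+1) <= 2^-(m+1) leave 2^-k, written in the form whose sum over k is
   known to be at most 2. *)
have layer k : (k.+1%:R `^ q * (rho ^+ (k * N.+1)) <= 2 / (2 ^ k.+1)%:R)%R.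
  apply: le_trans (_ : (2 ^+ m) ^+ k * ((2 ^+ m.+1)^-1) ^+ k <= _)%R; last first.
    rewrite -exprMn exprS invfM mulrCA mulfV ?expf_neq0// mulr1 natrX exprS.
    by rewrite invfM mulVKf// exprVn.
  apply: ler_pM; rewrite ?powR_ge0 ?exprn_ge0 ?(ltW rho0)//.
    apply: le_trans (_ : _ <= k.+1%:R `^ m%:R)%R _.
      by rewrite ler_powR// ler1n.
    rewrite powR_mulrn ?ler0n// -exprM mulnC exprM.
    apply: lerXn2r; rewrite ?nnegrE ?ler0n ?exprn_ge0//.
    by rewrite -natrX ler_nat ltn_expl.
  rewrite mulnC exprM; apply: lerXn2r; rewrite ?nnegrE ?invr_ge0 ?exprn_ge0 ?(ltW rho0)//.
  rewrite exprS; apply: le_trans (ltW rhoN).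
  by rewrite ler_piMl ?(ltW rho1)// exprn_ge0// ltW.
exists (N.+1%:R)%R => // E g u lam V lam0 V0 g0 dec.
pose L := (lam * N.+1%:R)%R; have L0 : (0 < L)%R by rewrite mulr_gt0.
pose F k := [set x | E x /\ (k%:R * L < g x)%R].
apply: le_trans (_ : _ <= \esum_(k in [set: nat])
    C (F k) (fun x => ((k.+1%:R * L) `^ q)%:E * u x)) _.
  apply: choquet_bigcup => x Ex gu.
  have gx0 : (0 < g x)%R.
    rewrite lt_neqAle g0 andbT eq_sym; apply/eqP => gx.
    by move: gu; rewrite gx poweR0r ?gt_eqF// mul0e ltxx.
  (* [u] may be negative somewhere, but not where the product is positive. *)
  have ux0 : 0 <= u x.
    rewrite leNgt; apply/negP => ux; move: gu; apply/negP; rewrite -leNgt.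
    by rewrite mule_ge0_le0// ?poweR_ge0// ltW.
  have ex : exists k, (g x <= k%:R * L)%R.
    exists (Num.trunc (g x / L)).+1.
    by rewrite -ler_pdivrMr// ltW// truncnS_gt.
  case: (ex_minnP ex) => -[|k]; first by rewrite mul0r leNgt gx0.
  move=> gk min; exists k; split => //.
    by split => //; rewrite ltNge; apply/negP => /min; rewrite ltnn.
  rewrite lee_wpmul2r// poweR_EFin lee_fin ge0_ler_powR ?nnegrE ?(ltW q0) ?(ltW gx0)//.
  by rewrite mulr_ge0// ltW.
have c0 : (0 <= L `^ q * K * V)%R by rewrite !mulr_ge0 ?powR_ge0// ltW.
apply: le_trans (_ : _ <= \esum_(k in [set: nat])
   ((L `^ q * K * V)%:E * (2 / (2 ^ k.+1)%:R)%:E)) _.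
  apply: le_esum => k _; rewrite choquetZ ?powR_gt0 ?mulr_gt0//.
  have -> : F k = [set x | E x /\ ((k * N.+1)%:R * lam < g x)%R].
    by rewrite /F /L natrM -mulrA (mulrC lam).
  apply: le_trans (lee_wpmul2l _ (dec _)) _; first by rewrite lee_fin powR_ge0.
  rewrite -!EFinM lee_fin powRM ?ler0n ?(ltW L0)//.
  have := ler_wpM2l c0 (layer k); apply: le_trans.
  rewrite le_eqVlt; apply/orP; left; apply/eqP; ring.
apply: le_trans (le_esumZl _ c0 _) _ => //.
have -> : ((L `^ q * K * 2 * V)%:E = (L `^ q * K * V)%:E * 2%:E).
  by rewrite -EFinM mulrAC.
apply: lee_wpmul2l; first by rewrite lee_fin.
by rewrite -nneseries_esumT//; exact: (epsilon_trick0 xpredT).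
Qed.
End john_nirenberg.

(** * Comparison of the norms *)

Section BLO_norms.
Context {R : realType} {n : nat} (delta : R).
Local Notation H := (@Hcontent R n delta).
Local Notation C := (@choquet R n delta).
Implicit Types (Q P : cube R n) (E : set 'rV[R]_n) (f : 'rV[R]_n -> R).

(* By scaling, H Q = H unit_cube * l(Q)^delta.  That H unit_cube > 0 when
   delta <= n need not be proved: if it vanishes, so do all the integrals. *)
Section degenerate.
Hypothesis content0 : H unit_cube = 0.

Lemma choquet_cube_content0 Q (f : 'rV[R]_n -> \bar R) : C Q f = 0.
Proof.
rewrite choquetE integral0_eq// => t _; apply/eqP.
rewrite eq_le Hcontent_ge0 andbT; apply: le_trans (_ : _ <= H Q) _.
  by apply: Hcontent_sub => x [].
by rewrite Hcontent_cubeE content0 mule0.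
Qed.

Lemma ereal_sup_range0 (F : cube R n -> \bar R) : (forall Q, F Q = 0) ->
  ereal_sup (range F) = 0.
Proof.
move=> F0; rewrite (_ : range F = [set 0]) ?ereal_sup1//.
apply/seteqP; split => [_ [Q _ <-]|_ ->]; first by rewrite /= F0.
by exists unit_cube.
Qed.

Lemma BLO_norm_content0 f : BLO_norm delta f = 0.
Proof.
by apply: ereal_sup_range0 => Q; rewrite /choquet_avg choquet_cube_content0 mule0.
Qed.

Lemma BLOqw_norm_content0 q w f : (0 < q)%R -> BLOqw_norm delta q w f = 0.
Proof.
move=> q0; apply: ereal_sup_range0 => Q.
by rewrite !choquet_cube_content0 mule0 poweR0r// gt_eqF// divr_gt0.
Qed.
End degenerate.

Section nondegenerate.
Hypothesis delta_gt0 : (0 < delta)%R.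
Hypothesis content_gt0 : 0 < H unit_cube.

Lemma BLO_norm_ge0 f : 0 <= BLO_norm delta f.
Proof.
apply: le_trans (ereal_sup_ubound _); last by exists unit_cube.
exact: choquet_avg_ge0.
Qed.

Lemma BLOqw_norm_ge0 q w f : 0 <= BLOqw_norm delta q w f.
Proof.
apply: le_trans (ereal_sup_ubound _); last by exists unit_cube.
exact: poweR_ge0.
Qed.

Section essinf.
Variable f : 'rV[R]_n -> R.
Hypothesis f_BLO : BLO_norm delta f < +oo.

(** The value -oo would make the oscillation infinite on Q, and Markov would push its average above
    the norm; +oo would make all sets {f < k}, which cover Q, null. *)
Lemma essinf_fin Q : essinf delta Q f \is a fin_num.
Proof.
rewrite fin_numE; apply/andP; split; apply/eqP => eQ.
  have NE : BLO_norm delta f = (fine (BLO_norm delta f))%:E.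
    by rewrite fineK// ge0_fin_numE// BLO_norm_ge0.
  set N := fine _ in NE.
  have N0 : (0 < N + 1)%R by rewrite ltr_wpDl// -lee_fin -NE BLO_norm_ge0.
  have : (N + 1)%:E <= BLO_norm delta f.
    apply: le_trans (ereal_sup_ubound _); last by exists Q.
    apply: choquet_avg_ge => //.
    apply: le_trans (choquet_markov delta Q _ N0).
    apply: lee_wpmul2l; first by rewrite lee_fin ltW.
    apply: Hcontent_sub => x Qx.
    by split => //; rewrite eQ /= ltry.
  by rewrite NE lee_fin gerDl ler10.
have := Hcontent_cube_gt0 content_gt0 Q.
rewrite (@Hcontent_bigcup0 _ _ _ (fun k => [set x | cube_set Q x /\ (f x < k%:R)%R]))//.
- by rewrite ltxx.
- move=> x Qx; exists (Num.trunc (f x)).+1 => //; split => //.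
  exact: truncnS_gt.
- move=> k; apply/eqP; rewrite eq_le Hcontent_ge0 andbT leNgt; apply/negP => fk.
  have : essinf delta Q f <= k%:R%:E by apply: ereal_inf_lbound; exists k%:R.
  by rewrite eQ.
Qed.

Definition fessinf Q : R := fine (essinf delta Q f).

Lemma essinfE Q : essinf delta Q f = (fessinf Q)%:E.
Proof. by rewrite fineK// essinf_fin. Qed.

Lemma fessinf_le Q t : 0 < H [set x | cube_set Q x /\ (f x <= t)%R] ->
  (fessinf Q <= t)%R.
Proof.
move=> ft; apply/ler_addgt0Pr => e e0; rewrite -lee_fin -essinfE.
apply: ereal_inf_lbound; exists (t + e)%R => //; apply: lt_le_trans ft _.
apply: Hcontent_sub => x [Qx fx]; split => //; apply: le_lt_trans fx _.
by rewrite ltrDl.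
Qed.

Lemma Hcontent_lt_fessinf Q : H [set x | cube_set Q x /\ (f x < fessinf Q)%R] = 0.
Proof.
apply: (@Hcontent_bigcup0 _ _ _ (fun k =>
  [set x | cube_set Q x /\ (f x <= fessinf Q - k.+1%:R^-1)%R])).
  move=> x [Qx fx]; have d0 : (0 < fessinf Q - f x)%R by rewrite subr_gt0.
  exists (Num.trunc (fessinf Q - f x)^-1) => //; split => //.
  rewrite lerBrDl -lerBrDr ltW// invf_plt ?posrE//.
  exact: truncnS_gt.
move=> k; apply/eqP; rewrite eq_le Hcontent_ge0 andbT leNgt; apply/negP.
by move=> /fessinf_le; rewrite lerBrDr gerDl leNgt invr_gt0 ltr0n.
Qed.

(** Below its essential infimum f lives on a null set, so only the upper deviation counts. *)
Lemma Hcontent_osc Q (s : R) : (0 <= s)%R ->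
  H [set x | cube_set Q x /\ (s < `|f x - fessinf Q|)%R] <=
  H [set x | cube_set Q x /\ (fessinf Q + s < f x)%R].
Proof.
move=> s0; rewrite -[leRHS]adde0 -(Hcontent_lt_fessinf Q).
apply: Hcontent_setU => x [Qx sf].
have [fe|fe] := ltP (f x) (fessinf Q); [by right|left].
by split => //; move: sf; rewrite ger0_norm ?subr_ge0// ltrBrDl.
Qed.

End essinf.

Lemma oscillation_decay : exists2 eta : R, (0 < eta)%R &
  forall (f : 'rV[R]_n -> R) (lam : R),
    BLO_norm delta f < +oo -> (0 < lam)%R ->
    (forall Q, H [set x | cube_set Q x /\ (fessinf f Q + lam < f x)%R] <=
      eta%:E * H Q) ->
  forall Q k, H [set x | cube_set Q x /\ (k%:R * lam < `|f x - fessinf f Q|)%R] <=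
    (4^-1 ^+ k)%:E * H Q.
Proof.
have [eta eta0 jn] := john_nirenberg delta_gt0 content_gt0; exists eta => //.
move=> f lam fB lam0 small Q [|k].
  by rewrite expr0 mul1e; apply: Hcontent_sub => x [].
apply: le_trans (Hcontent_osc fB _ _) _; first by rewrite mulr_ge0// ltW.
by apply: jn => // P t; exact: fessinf_le.
Qed.

Section weighted.
Variables (w : 'rV[R]_n -> \bar R) (q : R).
Hypothesis q_gt0 : (0 < q)%R.
Hypothesis w_median : median_bound delta w.
Hypothesis w_gt0 : forall Q, 0 < C (cube_set Q) w.
Hypothesis w_lty : forall Q, C (cube_set Q) w < +oo.

Let w_fin Q : C Q w \is a fin_num.
Proof. by rewrite ge0_fin_numE ?choquet_ge0. Qed.

Let fw_gt0 Q : (0 < fine (C Q w))%R.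
Proof. by rewrite fine_gt0// w_gt0 w_lty. Qed.

Lemma BLOqw_norm_le_BLO_norm : exists2 c : R, (0 < c)%R & forall f,
  BLO_norm delta f < +oo -> BLOqw_norm delta q w f <= c%:E * BLO_norm delta f.
Proof.
have [eta eta0 osc] := oscillation_decay.
have [a [gam [a0 /andP[gam0 gam1] Ainf]]] :=
  choquet_A_infty delta_gt0 content_gt0 w_median w_gt0 w_lty.
(* The decay 4^-k of the content absorbs the factor 2^k: a 2^k 4^-k + gam^k <= (a + 1) rho^k. *)
pose rho := Num.max 2^-1%R gam.
have rho01 : (0 < rho < 1)%R.
  by rewrite lt_max invr_gt0 ltr0n gt_max gam1 invf_lt1 ?ltr1n.
have a1 : (0 < a + 1)%R by rewrite addr_gt0.
have [B B0 layers] := @choquet_layers R n delta q rho (a + 1)%R q_gt0 rho01 a1.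
pose K := ((a + 1) * 2)%R; have K0 : (0 < K)%R by rewrite mulr_gt0.
exists (B / eta * K `^ (1 / q))%R; first by rewrite mulr_gt0 ?powR_gt0// divr_gt0.
move=> f fB; apply: le_of_real_bounds; [|exact: BLO_norm_ge0|move=> A A0 NA].
  by rewrite mulr_gt0 ?powR_gt0// divr_gt0.
(* Markov at this height gives content at most (A / lam) H(Q) = eta H(Q). *)
pose lam := (A / eta)%R; have lam0 : (0 < lam)%R by rewrite divr_gt0.
have small Q : H [set x | cube_set Q x /\ (fessinf f Q + lam < f x)%R] <=
    eta%:E * H Q.
  rewrite -(@lee_pmul2l _ lam%:E)//.
  have -> : lam%:E * (eta%:E * H Q) = A%:E * H Q.
    by rewrite muleA -EFinM divfK// gt_eqF.
  have : choquet_avg delta Q (fun x => `|(f x)%:E - essinf delta Q f|) <= A%:E.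
    by apply: le_trans NA; apply: ereal_sup_ubound; exists Q.
  move=> /choquet_avg_le-/(_ content_gt0); apply: le_trans.
  apply: le_trans (choquet_markov delta Q _ lam0).
  apply: lee_wpmul2l; first by rewrite lee_fin ltW.
  apply: Hcontent_sub => x [Qx fx]; split => //.
  by rewrite essinfE// -EFinB lte_fin (lt_le_trans _ (ler_norm _))// ltrBrDl.
have decay := osc f lam fB lam0 small.
apply: ge_ereal_sup => _ [Q _ <-].
have : C Q (fun x => poweR `|f x - fessinf f Q|%:E q * w x) <=
    ((lam * B) `^ q * (a + 1) * 2 * fine (C Q w))%:E.
  apply: (layers Q (fun x => `|f x - fessinf f Q|%R)) => //; first exact: ltW.
  move=> k; rewrite EFinM fineK//.
  apply: le_trans (Ainf Q _ _ k _ (decay Q k)) _; first by move=> x [].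
  apply: lee_wpmul2r; first exact: ltW.
  rewrite lee_fin mulrDl mul1r lerD//.
    rewrite -mulrA ler_pM2l// -exprMn lerXn2r ?nnegrE ?mulr_ge0//.
      by rewrite le_max invr_ge0 ler0n.
    by rewrite le_max; apply/orP; left; lra.
  rewrite lerXn2r ?nnegrE ?(ltW gam0)// le_max ?lexx ?orbT//.
  by rewrite invr_ge0 ler0n.
have := fw_gt0 Q; rewrite -(fineK (w_fin Q)); set W := fine _ => W0 le_layers.
rewrite inver gt_eqF//.
under eq_fun do rewrite essinfE// -EFinB.
apply: le_trans (_ : _ <= poweR ((lam * B) `^ q * K)%:E (1 / q)) _.
  apply: gt0_ler_poweR; rewrite ?in_itv/= ?leey ?andbT.
  - by rewrite divr_ge0// ltW.
  - by rewrite mule_ge0 ?choquet_ge0// lee_fin invr_ge0 ltW.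
  - by rewrite lee_fin mulr_ge0 ?powR_ge0// ltW.
  rewrite lee_pdivrMl//; apply: le_trans le_layers _.
  by rewrite -EFinM lee_fin /K mulrC !mulrA.
rewrite poweR_EFin lee_fin powRM ?powR_ge0 ?(ltW K0)//.
have lamB : (0 <= lam * B)%R by rewrite ltW// mulr_gt0.
rewrite -powRrM div1r mulfV ?gt_eqF// powRr1//.
by rewrite le_eqVlt; apply/orP; left; apply/eqP; rewrite /lam; ring.
Qed.

Lemma BLO_norm_le_BLOqw_norm : exists2 c : R, (0 < c)%R & forall f,
  BLO_norm delta f < +oo -> BLO_norm delta f <= c%:E * BLOqw_norm delta q w f.
Proof.
have [eta eta0 osc] := oscillation_decay.
have [kappa kappa0 Asmall] :=
  choquet_small_content_small content_gt0 w_median w_gt0 w_lty eta0.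
have rho01 : (0 < (4^-1 : R) < 1)%R by rewrite invr_gt0 ltr0n invf_lt1 ?ltr1n.
have [B B0 layers] := @choquet_layers R n delta 1%R _ 1%R ltr01 rho01 ltr01.
(* Chosen so that, for lam = A / d, the weighted Markov bound (A / lam)^q w(Q) equals kappa w(Q). *)
pose d := (kappa `^ (1 / q))%R; have d0 : (0 < d)%R by rewrite powR_gt0.
have dq : (d `^ q = kappa)%R.
  by rewrite -powRrM div1r mulVf ?gt_eqF// powRr1// ltW.
exists (2 * B / d)%R; first by rewrite divr_gt0// mulr_gt0.
move=> f fB; apply: le_of_real_bounds; [|exact: BLOqw_norm_ge0|move=> A A0 NA].
  by rewrite divr_gt0// mulr_gt0.
pose lam := (A / d)%R; have lam0 : (0 < lam)%R by rewrite divr_gt0.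
have lamq : (0 < lam `^ q)%R by rewrite powR_gt0.
have small Q : H [set x | cube_set Q x /\ (fessinf f Q + lam < f x)%R] <=
    eta%:E * H Q.
  apply: Asmall; first by move=> x [].
  rewrite -(@lee_pmul2l _ (lam `^ q)%:E)// -(choquetZ _ _ _ lamq).
  apply: le_trans (_ : _ <= C Q (fun x =>
      poweR `|(f x)%:E - essinf delta Q f| q * w x)) _.
        apply: le_choquet => t t0; apply: Hcontent_sub => x [[Qx fx] tw]; split => //.
    (* The weight is controlled only almost everywhere; its sign at x follows from 0 < t < lam^q
       w(x). *)
    have wx : 0 <= w x.
      rewrite leNgt; apply/negP => wx; move: tw; apply/negP; rewrite -leNgt.
      apply: le_trans (_ : _ <= 0) _; last by rewrite lee_fin ltW.
      by rewrite mule_ge0_le0// ?lee_fin ltW.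
    apply: lt_le_trans tw _.
    apply: lee_wpmul2r => //; rewrite essinfE// -EFinB /= lee_fin.
    rewrite ge0_ler_powR ?nnegrE ?(ltW q_gt0) ?(ltW lam0)//.
    by rewrite (le_trans _ (ler_norm _))// lerBrDl ltW.
  have : poweR ((C Q w)^-1 * C Q (fun x =>
      poweR `|(f x)%:E - essinf delta Q f| q * w x)) (1 / q) <= A%:E.
    by apply: le_trans NA; apply: ereal_sup_ubound; exists Q.
  set X := C Q (fun x => _ * _); have X0 : 0 <= X by exact: choquet_ge0.
  have := fw_gt0 Q; rewrite -(fineK (w_fin Q)); set W := fine _ => W0.
  have WX0 : 0 <= W%:E^-1 * X by rewrite mule_ge0// inve_ge0 lee_fin ltW.
  move=> /(@gt0_ler_poweR _ q (ltW q_gt0)); rewrite !in_itv/= !leey !andbT.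
  rewrite poweR_ge0 lee_fin => /(_ isT (ltW A0)).
  rewrite -poweRrM div1r mulVf ?gt_eqF// poweRe1//.
    rewrite inver gt_eqF// lee_pdivrMl// => /le_trans; apply.
  have -> : (A = lam * d)%R by rewrite divfK// gt_eqF.
  rewrite powRM ?(ltW lam0) ?(ltW d0)// dq.
  by rewrite -!EFinM lee_fin le_eqVlt; apply/orP; left; apply/eqP; ring.
have decay := osc f lam fB lam0 small.
apply: ge_ereal_sup => _ [Q _ <-].
have h0 := fine_Hcontent_cube_gt0 content_gt0 Q.
have hE := fineK (Hcontent_cube_fin content_gt0 Q).
rewrite /choquet_avg.
(* The unweighted oscillation is put in the form of [choquet_layers] with exponent 1 and weight
   1. *)
rewrite (_ : (fun x => `|(f x)%:E - essinf delta Q f|) =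
    (fun x => poweR `|f x - fessinf f Q|%:E 1 * 1)); last first.
  by apply/funext => x; rewrite mule1 essinfE// -EFinB poweRe1// lee_fin.
rewrite -hE inver gt_eqF// lee_pdivrMl//.
apply: le_trans (layers Q (fun x => `|f x - fessinf f Q|%R) (fun=> 1) lam _
  lam0 (ltW h0) _ _) _ => //.
  by move=> k; rewrite choquet1 mul1r EFinM hE; exact: decay.
have lamB : (0 <= lam * B)%R by rewrite ltW// mulr_gt0.
rewrite -EFinM lee_fin powRr1// mulr1.
by rewrite le_eqVlt; apply/orP; left; apply/eqP; rewrite /lam; ring.
Qed.

End weighted.
End nondegenerate.
End BLO_norms.

Theorem theorem1p15 (R : realType) (n : nat) (delta p q : R)
    (w : 'rV[R]_n -> \bar R)
    (delta_gt0 : (0 < delta)%R) (delta_le : (delta <= n%:R)%R)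
    (p_ge1 : (1 <= p)%R) (q_gt0 : (0 < q)%R) (hw : Aclass delta p w) :
  exists C : R, (0 < C)%R /\
    forall f : 'rV[R]_n -> R, BLO delta f ->
      (1 / C)%R%:E * BLO_norm delta f <= BLOqw_norm delta q w f /\
      BLOqw_norm delta q w f <= C%:E * BLO_norm delta f.
Proof.
have [content0|content_gt0] := eqVneq (Hcontent delta (@unit_cube R n)) 0.
  exists 1%R; split=> // f _.
  by rewrite BLO_norm_content0// BLOqw_norm_content0// !mule0.
have {}content_gt0 : 0 < Hcontent delta (@unit_cube R n).
  by rewrite lt_neqAle eq_sym content_gt0 Hcontent_ge0.
have w_median := Aclass_median_bound content_gt0 p_ge1 hw.
have [[w_loc w_pos] _] := hw.
have w_gt0 Q := choquet_cube_gt0 content_gt0 Q w_pos.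
have w_lty Q := choquet_cube_lty Q w_loc.
have [c1 c10 up] := BLOqw_norm_le_BLO_norm delta_gt0 content_gt0 q_gt0 w_median w_gt0 w_lty.
have [c2 c20 low] := BLO_norm_le_BLOqw_norm delta_gt0 content_gt0 q_gt0 w_median w_gt0 w_lty.
exists (Num.max c1 c2); split; first by rewrite lt_max c10.
move=> f [_ fB]; split.
  rewrite div1r lee_pdivrMl; last by rewrite lt_max c10.
  apply: le_trans (low f fB) _; apply: lee_wpmul2r; first exact: BLOqw_norm_ge0.
  by rewrite lee_fin le_max lexx orbT.
apply: le_trans (up f fB) _; apply: lee_wpmul2r; first exact: BLO_norm_ge0.
by rewrite lee_fin le_max lexx.
Qed.
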